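(* Let $C\subset\mathbb{R}^n$ be a non-empty, compact and convex set, let $K:C\rightrightarrows\mathbb{R}^n$ be a set-valued map and let $f:\mathbb{R}^n\times\mathbb{R}^n\to\mathbb{R}$ be a bifunction. Let $P_C$ be the Euclidean projection onto $C$ and define $Q:C\times\mathbb{R}^n\rightrightarrows C\times\mathbb{R}^n$ by $Q(x,z)=P_C(z)\times K(x)$. Assume that 1. $Q$ is lower semicontinuous with non-empty convex values; 2. $Q(C\times\mathbb{R}^n)$ is relatively compact; 3. $\mathrm{Fix}(Q)$ is closed; 4. the set-valued map $G:\mathrm{Fix}(Q)\rightrightarrows\mathbb{R}^n$ defined by $G(x,z)=\{y\in K(x): f(y,z)>0\}$ is lower semicontinuous; 5. $f$ is properly quasimonotone on $\mathrm{co}(K(C))$. Then there exists a projected solution of the Minty quasi-equilibrium problem associated to $f$ and $K$. Moreover, the set of projected solutions of the quasi-equilibrium problem associated to $f$ and $K$ is non-empty if $f$ has the upper sign property (on $\mathbb{R}^n$) or $-f$ is pseudomonotone (on $\mathbb{R}^n$).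
   Context: $\|\cdot\|$ is the Euclidean norm and $P_C(z)=\{x\in C:\|z-x\|\le\|z-w\|\ \text{for all } w\in C\}$. $\mathrm{co}$ denotes convex hull. For $\Phi:X\rightrightarrows X$, $\mathrm{Fix}(\Phi)=\{x: x\in\Phi(x)\}$; $\Phi(A)=\bigcup_{a\in A}\Phi(a)$. Values of set-valued maps may be empty unless stated otherwise. $\Phi:X\rightrightarrows Y$ is lower semicontinuous if for any $x_0$, any net $(x_i)$ converging to $x_0$ and any $y_0\in \Phi(x_0)$, there exist a subnet $(x_{\varphi(j)})_{j\in J}$ and a net $(y_j)_{j\in J}$ converging to $y_0$ with $y_j\in\Phi(x_{\varphi(j)})$ for all $j$. A bifunction $g:\mathbb{R}^n\times\mathbb{R}^n\to\mathbb{R}$ is: pseudomonotone on $D\subset\mathbb{R}^n$ if for all $x,y\in D$, $g(x,y)\ge0\Rightarrow g(y,x)\le 0$; properly quasimonotone on a convex set $D$ if for all $x_1,\dots,x_m\in D$ and all $x\in\mathrm{co}(\{x_1,\dots,x_m\})$ there is $i$ with $g(x_i,x)\le 0$. $g$ has the upper sign property on a convex set $D$ if for all $x,y\in D$: ($g((1-t)x+ty,x)\le0$ for all $t\in]0,1[$) implies $g(x,y)\ge 0$. For $D\subset\mathbb{R}^n$, $\mathrm{EP}(f,D)=\{x\in D: f(x,y)\ge 0\ \forall y\in D\}$ and $\mathrm{MEP}(f,D)=\{x\in D: f(y,x)\le 0\ \forall y\in D\}$. A projected solution of the quasi-equilibrium problem (respectively Minty quasi-equilibrium problem) associated to $f$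 and $K$ is a point $x_0\in C$ for which there exists $z_0\in\mathrm{EP}(f,K(x_0))$ (respectively $z_0\in\mathrm{MEP}(f,K(x_0))$) with $x_0\in P_C(z_0)$. *)

(* Defs.v *)
From HB Require Import structures.
From mathcomp Require Import all_boot all_order all_algebra.
From mathcomp Require Import all_classical all_reals all_analysis.

Set Implicit Arguments.
Unset Strict Implicit.
Unset Printing Implicit Defensive.

Import Order.TTheory GRing.Theory Num.Theory.
Import numFieldNormedType.Exports.

Local Open Scope classical_set_scope.
Local Open Scope ring_scope.

Record directed (I : Type) (le : I -> I -> Prop) : Prop := Directed {
  directed_inhabited : inhabited I ;
  directed_refl : forall i, le i i ;
  directed_trans : forall i j k, le i j -> le j k -> le i k ;
  directed_ub : forall i j, exists k, le i k /\ le j k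
}.

(* [u @ net_tails le --> l] is convergence of the net [u] indexed by [(I, le)]. *)
Definition net_tails (I : Type) (le : I -> I -> Prop) : set_system I :=
  [set A | exists i0, forall i, le i0 i -> A i].

(* Subnets in the sense of Kelley: the reindexing map need not be monotone. *)
Definition cofinal_map (I J : Type) (leI : I -> I -> Prop)
    (leJ : J -> J -> Prop) (phi : J -> I) : Prop :=
  forall i0, exists j0, forall j, leJ j0 j -> leI i0 (phi j).

(* A set-valued map with domain [D], a subset of [X], is encoded by a total
   function [X -> set Y] together with [D]; its values outside [D] are ignored. *)
Section SetValuedMaps.
Variables X Y : topologicalType.
Implicit Types (D : set X) (Phi : X -> set Y).

(* Nets and limits are taken in [D]: the subspace topology is meant. *)
Definition lower_semicontinuous_on D Phi : Prop :=
  forall (x0 : X) (I : Type) (leI : I -> I -> Prop) (x : I -> X) (y0 : Y),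
    D x0 -> directed leI -> (forall i, D (x i)) ->
    x @ net_tails leI --> x0 -> Phi x0 y0 ->
    exists (J : Type) (leJ : J -> J -> Prop) (phi : J -> I) (y : J -> Y),
      [/\ directed leJ, cofinal_map leI leJ phi,
          y @ net_tails leJ --> y0 & forall j, Phi (x (phi j)) (y j)].

End SetValuedMaps.

Definition image_on (X Y : Type) (D : set X) (Phi : X -> set Y) : set Y :=
  \bigcup_(x in D) Phi x.

Definition Fix_on (X : Type) (D : set X) (Phi : X -> set X) : set X :=
  [set x | D x /\ Phi x x].

Definition convex_hull (R : realType) (E : lmodType R) (A : set E) : set E :=
  smallest (@convex_set R E) A.

Section EuclideanProjection.
Variables (R : realType) (n : nat).

(* The library norm on ['rV[R]_n] is the sup norm. *)
Definition enorm (x : 'rV[R]_n) : R := Num.sqrt (\sum_(i < n) x ord0 i ^+ 2).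

Definition proj (C : set 'rV[R]_n) (z : 'rV[R]_n) : set 'rV[R]_n :=
  [set x | C x /\ forall w, C w -> enorm (z - x) <= enorm (z - w)].

End EuclideanProjection.

Section Bifunctions.
Variables (R : realType) (n : nat).
Implicit Types (g : 'rV[R]_n -> 'rV[R]_n -> R) (D : set 'rV[R]_n).

Definition pseudomonotone g D : Prop :=
  forall x y, D x -> D y -> 0 <= g x y -> g y x <= 0.

Definition properly_quasimonotone g D : Prop :=
  forall (m : nat) (x : 'I_m -> 'rV[R]_n), (forall i, D (x i)) ->
  forall y, convex_hull (range x) y -> exists i, g (x i) y <= 0.

Definition upper_sign_property g D : Prop :=
  forall x y, D x -> D y ->
    (forall t : R, 0 < t < 1 -> g ((1 - t) *: x + t *: y) x <= 0) ->
    0 <= g x y.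

Definition EP g D : set 'rV[R]_n :=
  [set x | D x /\ forall y, D y -> 0 <= g x y].

Definition MEP g D : set 'rV[R]_n :=
  [set x | D x /\ forall y, D y -> g y x <= 0].

Definition projected_solutions (C : set 'rV[R]_n)
    (K : 'rV[R]_n -> set 'rV[R]_n) g : set 'rV[R]_n :=
  [set x0 | C x0 /\ exists2 z0, EP g (K x0) z0 & proj C z0 x0].

Definition minty_projected_solutions (C : set 'rV[R]_n)
    (K : 'rV[R]_n -> set 'rV[R]_n) g : set 'rV[R]_n :=
  [set x0 | C x0 /\ exists2 z0, MEP g (K x0) z0 & proj C z0 x0].

Definition Qmap (C : set 'rV[R]_n) (K : 'rV[R]_n -> set 'rV[R]_n)
    (p : 'rV[R]_n * 'rV[R]_n) : set ('rV[R]_n * 'rV[R]_n) :=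
  proj C p.2 `*` K p.1.

Definition Gmap (K : 'rV[R]_n -> set 'rV[R]_n) g
    (p : 'rV[R]_n * 'rV[R]_n) : set 'rV[R]_n :=
  [set y | K p.1 y /\ 0 < g y p.2].

End Bifunctions.

(* Main.v *)
(* Suppose that no Minty solution exists. On the points z with z in K(P_C z),
   that is, on the fixed points (P_C z, z) of Q, put H(z) = co G(P_C z, z), which
   is then non-empty; elsewhere put H(z) = K(P_C z). Since Fix(Q) is closed and H
   is a submap of z |-> K(P_C z), the map H is lower semicontinuous with convex
   values, so it has a fixed point z. Then z lies in K(P_C z), hence in
   co G(P_C z, z), which contradicts proper quasimonotonicity.

   The values of H need not be closed, so the fixed point theorem for lower
   semicontinuous maps requires Michael's finite-dimensional selection theorem:
   closures of the values admit continuous selections, countably many of them are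
   pointwise dense, and a weighted average of a dense sequence falls in the
   relative interior of the value. Brouwer's theorem is then applied to the
   selection. Brouwer's theorem comes from Scarf's combinatorial lemma on families
   of linear orders (in the form of Petri and Voorneveld), which plays the role of
   Sperner's lemma without any triangulation. *)

Require Import Defs.
From HB Require Import structures.
From mathcomp Require Import all_boot all_order all_algebra.
From mathcomp Require Import zify.

Set Implicit Arguments.
Unset Strict Implicit.
Unset Printing Implicit Defensive.

(** * Scarf's lemma *)

(** Both sides run over the pairs [A], [B = x |: A]; in [scarf] this turns sums over doors into sums
    over rooms. *)
Lemma exchange_setU1_setD1 (S : finType) (F : {set S} -> {set S} -> nat) :
  \sum_(A : {set S}) \sum_(x | x \notin A) F A (x |: A) =
  \sum_(B : {set S}) \sum_(x in B) F (B :\ x) B.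
Proof.
rewrite (exchange_big_dep predT) //= [RHS](exchange_big_dep predT) //=.
apply: eq_bigr => x _.
rewrite (reindex_onto (fun B => B :\ x) (fun A => x |: A)) /=; last first.
  by move=> A xA; rewrite setU1K.
apply: eq_big => [B|B /andP[_ /eqP->] //]; rewrite !inE eqxx /=.
apply/eqP/idP => [<-|]; [exact: setU11|exact: setD1K].
Qed.

Section Scarf.
Variables (T I : finType) (r : I -> T -> nat).
Hypothesis r_inj : forall i, injective (r i).
Implicit Types (A : {set T}) (J D : {set I}).

(* No element of T is strictly better, for every order in J, than the worst
   element of A. A dominant pair is called a room when #|A| = #|J| and a door
   when #|A| + 1 = #|J|; a door of a room arises by removing an element from A or
   by adding one to J. *)
Definition dominant A J :=
  [forall t, [exists j in J, [forall a in A, r j t <= r j a]]].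

Lemma dominantP A J :
  reflect (forall t, exists2 j, j \in J & forall a, a \in A -> r j t <= r j a)
          (dominant A J).
Proof.
apply: (iffP forallP) => H t.
  by have /existsP[j /andP[jJ /forall_inP jt]] := H t; exists j.
have [j jJ jt] := H t; apply/existsP; exists j; rewrite jJ /=.
exact/forall_inP.
Qed.

Lemma dominant_sub A A' J J' :
  A' \subset A -> J \subset J' -> dominant A J -> dominant A' J'.
Proof.
move=> /subsetP sA /subsetP sJ /dominantP dA; apply/dominantP => t.
by have [j /sJ jJ' jt] := dA t; exists j => // a /sA; exact: jt.
Qed.

Section Door.
Variables (A : {set T}) (D : {set I}) (a0 : T).
Hypotheses (a0A : a0 \in A) (domAD : dominant A D) (cardD : #|D| = #|A|.+1).

Let g j := [arg min_(a < a0 in A) r j a].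

Let gA j : g j \in A.
Proof. by rewrite /g; case: arg_minnP. Qed.

Let g_min j a : a \in A -> r j (g j) <= r j a.
Proof. by rewrite /g; case: arg_minnP => // b _; apply. Qed.

Let g_eq j a : a \in A -> (forall b, b \in A -> r j a <= r j b) -> g j = a.
Proof.
by move=> aA amin; apply: (@r_inj j); apply/eqP; rewrite eqn_leq g_min //= amin.
Qed.

(* Removing j from D loses a minimum; exactly two elements of D are not
   essential, and they lead to the two rooms adjacent to the door (A, D). *)
Let essential j := ~~ [forall a in A, [exists k in D :\ j, g k == a]].

(** Dominance makes [g] map [D] onto [A]. As [D] has one element more than [A], exactly one fibre of
    [g] is a pair and the others are singletons; the inessential indices are that pair. *)
Let card_inessential : \sum_(j in D) (~~ essential j : nat) = 2.
Proof.
have [i0 i0D] : exists i0, i0 \in D by apply/card_gt0P; rewrite cardD.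
have /fin_all_exists[s s_sec] : forall a, exists j, a \in A -> j \in D /\ g j = a.
  move=> a; case aA: (a \in A); last by exists i0.
  have /dominantP/(_ a)[j jD ja] := domAD.
  by exists j => _; split=> //; apply: g_eq.
have sD a : a \in A -> s a \in D by move/s_sec => [].
have sg a : a \in A -> g (s a) = a by move/s_sec => [].
have s_inj : {in A &, injective s}.
  by move=> a b aA bA /(congr1 g); rewrite !sg.
have sAD : s @: A \subset D by apply/subsetP => _ /imsetP[a aA ->]; exact: sD.
(* [j0] is the only index that the section [s] of [g] misses; its partner [j1] below has the same
   minimum. *)
have /cards1P[j0 j0E] : #|D :\: s @: A| == 1.
  by rewrite cardsD (setIidPr sAD) cardD (card_in_imset s_inj) subSnn.
have /setDP[j0D j0s] : j0 \in D :\: s @: A by rewrite j0E set11.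
have DsE j : j \in D -> j != j0 -> j = s (g j).
  move=> jD jj0; have : j \notin D :\: s @: A by rewrite j0E inE.
  by rewrite inE jD andbT negbK => /imsetP[a aA ->]; rewrite sg.
pose j1 := s (g j0).
have j1D : j1 \in D by apply: sD.
have j10 : j1 != j0.
  by apply: contraNneq j0s => <-; apply: imset_f.
rewrite (bigD1 j0) //= (bigD1 j1) /=; last by rewrite j1D.
have -> : ~~ essential j0.
  rewrite negbK; apply/forall_inP => a aA; apply/exists_inP; exists (s a).
    rewrite !inE sD // andbT; apply: contraNneq j0s => <-; exact: imset_f.
  by rewrite sg.
have -> : ~~ essential j1.
  rewrite negbK; apply/forall_inP => a aA; apply/exists_inP.
  have [aj0|aj0] := eqVneq (g j0) a.
    by exists j0; rewrite ?inE ?j0D ?aj0 // eq_sym j10.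
  exists (s a); last by rewrite sg.
  rewrite !inE sD // andbT; apply: contra_neq aj0 => /(congr1 g).
  by rewrite !sg.
rewrite big1 // => j /andP[/andP[jD jj0] jj1]; rewrite negbK.
apply/eqP; rewrite eqb0; apply/negP => /forall_inP/(_ _ (gA j))/exists_inP[k].
rewrite !inE => /andP[kj kD] /eqP gk.
have [kj0|kj0] := eqVneq k j0.
  by move/eqP: jj1; apply; rewrite /j1 -kj0 gk -DsE.
by move/eqP: kj; apply; rewrite (DsE _ kD kj0) gk -DsE.
Qed.

(** Each element of [A] must remain the minimum for some index at which [x] lies above it. This uses
    up at least [#|A|] of the [#|A| + 1] indices of [D] and leaves one at most. *)
Let below_uniq x j k : x \notin A -> dominant (x |: A) D ->
  j \in D -> k \in D -> r j x < r j (g j) -> r k x < r k (g k) -> j = k.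
Proof.
move=> xA dx jD kD jx kx; apply/eqP/negPn/negP => jk.
pose D' := [set i in D | r i (g i) < r i x].
have AD' : A \subset g @: D'.
  apply/subsetP => a aA; have /dominantP/(_ a)[i iD ia] := dx.
  have gi : g i = a by apply: g_eq => // b bA; rewrite ia ?inE ?bA ?orbT.
  apply/imsetP; exists i => //; rewrite inE iD gi /= ltn_neqAle ia ?setU11 //.
  by rewrite andbT (inj_eq (@r_inj i)); apply: contraNneq xA => <-.
have cD' : #|D' :|: [set j; k]| <= #|D|.
  apply/subset_leq_card/subsetP => i; rewrite !inE.
  by case/or3P => [/andP[]//|/eqP->|/eqP->].
have : #|A| <= #|D'| := leq_trans (subset_leq_card AD') (leq_imset_card _ _).
move: cD'; rewrite cardsU cards2 jk cardD /=.
have -> : D' :&: [set j; k] = set0.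
  apply/setP => i; rewrite !inE; apply/negP => /andP[/andP[_ xi]] /orP[] /eqP ik.
    by move: xi jx; rewrite ik; lia.
  by move: xi kx; rewrite ik; lia.
rewrite cards0; lia.
Qed.

(** For an essential [j], some element of [A] is the minimum for [j] alone; dropping [j], or placing
    a new element below it, destroys dominance. For an inessential [j], either dropping [j] gives a
    room or exactly one new element does. *)
Let room_count j : j \in D ->
  \sum_(x | x \notin A) (dominant (x |: A) D && (r j x < r j (g j)) : nat)
    + dominant A (D :\ j) = ~~ essential j.
Proof.
move=> jD; have [ej|] := boolP (essential j).
  rewrite big1 ?add0n => [|x xA].
    apply/eqP; rewrite eqb0; apply: contraTN ej => /dominantP dA.
    rewrite negbK; apply/forall_inP => a aA; apply/exists_inP.
    by have [k kD ka] := dA a; exists k => //; apply/eqP/g_eq.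
  apply/eqP; rewrite eqb0; apply: contraTN ej => /andP[/dominantP dA xj].
  rewrite negbK; apply/forall_inP => a aA; apply/exists_inP.
  have [k kD ka] := dA a; exists k.
    rewrite !inE kD andbT; apply/eqP => kj.
    have := ka x; rewrite setU11 => /(_ isT); rewrite kj.
    by have := g_min j aA; lia.
  by apply/eqP/g_eq => // b bA; apply: ka; rewrite !inE bA orbT.
rewrite negbK => /forall_inP nej; have [dj|] := boolP (dominant A (D :\ j)).
  rewrite big1 // => x xA; apply/eqP; rewrite eqb0; apply/negP => /andP[dx xj].
  have /dominantP/(_ x)[k] := dj; rewrite !inE => /andP[kj kD] kx.
  move/eqP: kj; apply; apply: (@below_uniq x) => //.
  rewrite ltn_neqAle kx ?gA // andbT (inj_eq (@r_inj k)).
  by apply: contraNneq xA => ->.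
rewrite addn0 => /forallPn[t0 t0P].
(* These elements witness that [(A, D :\ j)] is not dominant; the best of them in the order [j] is
   the element to add. *)
pose M := [pred t | [forall k in D :\ j, r k (g k) < r k t]].
have Mt0 : M t0.
  apply/forall_inP => k kD; rewrite ltnNge; apply: contra t0P => kt.
  apply/existsP; exists k; rewrite kD; apply/forall_inP => a aA.
  exact: leq_trans kt (g_min _ aA).
have [x /forall_inP xM xmax] := arg_maxnP (r j) Mt0.
have xA : x \notin A.
  apply/negP => xA; have /exists_inP[k kD /eqP gk] := nej _ xA.
  by have := xM _ kD; rewrite gk ltnn.
have xj : r j x < r j (g j).
  have /dominantP/(_ x)[k kD kx] := domAD.
  have [kj|kj] := eqVneq k j; last first.
    by have := xM k; rewrite !inE kj kD => /(_ isT); rewrite ltnNge kx.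
  rewrite ltn_neqAle -{3}kj -kj kx // andbT (inj_eq (@r_inj k)).
  by apply: contraNneq xA => ->.
have dx : dominant (x |: A) D.
  apply/dominantP => t; have [tM|] := boolP (M t).
    exists j => // b; rewrite !inE => /orP[/eqP->|bA]; first exact: xmax.
    by apply: leq_trans (xmax _ tM) _; apply: leq_trans (ltnW xj) (g_min _ bA).
  rewrite negb_forall => /existsP[k]; rewrite negb_imply -leqNgt => /andP[kDj kt].
  exists k; first by move: kDj; rewrite !inE => /andP[].
  move=> b; rewrite !inE => /orP[/eqP->|bA].
    exact: leq_trans kt (ltnW (xM _ kDj)).
  exact: leq_trans kt (g_min _ bA).
(* Any other candidate [y] lies in [M] by [below_uniq], and dominance of [y |: A] tested at [x]
   forces [y] to be as good as [x] in the order [j]. *)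
rewrite (bigD1 x) //= dx xj big1 // => y /andP[yA yx].
apply/eqP; rewrite eqb0; apply: contra_neqN yx => /andP[dy yj].
have yM : M y.
  apply/forall_inP => k; rewrite !inE => /andP[kj kD].
  rewrite ltnNge leq_eqVlt (inj_eq (@r_inj k)) negb_or.
  apply/andP; split; first by apply: contraNneq yA => ->.
  by apply: contra_neqN kj => yk; apply: (@below_uniq y).
apply: (@r_inj j); apply/eqP; rewrite eqn_leq; apply/andP.
split; first exact: xmax.
have /dominantP/(_ x)[k kD kx] := dy; have [kj|kj] := eqVneq k j.
  by rewrite -kj kx // setU11.
have := xM k; rewrite !inE kj kD => /(_ isT).
by rewrite ltnNge kx // inE gA orbT.
Qed.

(** Each room [(x |: A, D)] is charged to the unique index at which [x] lies below [A]; summing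
    [room_count] over [D] then gives exactly two rooms. *)
Lemma inner_door_even :
  ~~ odd (\sum_(x | x \notin A) (dominant (x |: A) D : nat)
          + \sum_(j in D) (dominant A (D :\ j) : nat)).
Proof.
have -> : \sum_(x | x \notin A) (dominant (x |: A) D : nat) =
    \sum_(j in D) \sum_(x | x \notin A)
       (dominant (x |: A) D && (r j x < r j (g j)) : nat).
  rewrite exchange_big; apply: eq_bigr => x xA /=.
  case: (boolP (dominant _ _)) => dx /=; last by rewrite big1.
  have /dominantP/(_ x)[j jD jx] := dx.
  have xj : r j x < r j (g j).
    rewrite ltn_neqAle jx ?inE ?gA ?orbT // andbT (inj_eq (@r_inj j)).
    by apply: contraNneq xA => ->.
  rewrite (bigD1 j) //= xj big1 // => k /andP[kD kj].
  apply/eqP; rewrite eqb0; apply: contra_neqN kj => xk.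
  exact: (@below_uniq x).
by rewrite -big_split (eq_bigr _ room_count) card_inessential.
Qed.

End Door.

(** * Colourings and the parity argument *)

Variable c : T -> I.

(** For [i] outside [J], a door would force [c @: A = J]. Otherwise, if deleting [x] gives a door,
    then [c] is injective on [A :\ x]. Either [c x] repeats the colour of some [y], and the doors
    are the deletions of [x] and [y]; or [c x] is outside [J], and the only other door adds [c x] to
    [J]. If adding [j] gives a door, deleting the element coloured [j] gives one too. *)
Lemma uncoloured_room_even i A J : #|A| = #|J| -> c @: A != J ->
  ~~ odd (\sum_(x in A) ((i \in J) && (c @: (A :\ x) == J :\ i) : nat)
   + \sum_(j | j \notin J) ((i \in j |: J) && (c @: A == (j |: J) :\ i) : nat)).
Proof.
move=> cAJ cA; have [iJ|iJ] := boolP (i \in J); last first.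
  rewrite big1 // add0n big1 // => j jJ; apply/eqP; rewrite eqb0.
  rewrite in_setU1 (negbTE iJ) orbF; apply: contra cA => /andP[/eqP <-].
  by rewrite setU1K.
under [X in _ + X]eq_bigr => j jJ do rewrite in_setU1 iJ orbT /=.
have cJ : #|J| = #|J :\ i|.+1 by rewrite (cardsD1 i) iJ.
have [/existsP[x /andP[xA /eqP cx]]|] :=
  boolP [exists x in A, c @: (A :\ x) == J :\ i].
  have inj : {in A :\ x &, injective c}.
    by apply/imset_injP; rewrite cx -eqSS -cJ -cAJ (cardsD1 x A) xA.
  have cAE : c @: A = c x |: (J :\ i) by rewrite -cx -imsetU1 setD1K.
  have [cxJ|cxJ] := boolP (c x \in J :\ i).
    have := cxJ; rewrite -cx => /imsetP[y yA cxy].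
    rewrite (bigD1 x) //= cx eqxx (bigD1 y) /=; last first.
      by move: yA; rewrite !inE andbC.
    have -> : c @: (A :\ y) == J :\ i.
      rewrite -cx eq_sym eqEcard; apply/andP; split.
        apply/subsetP => _ /imsetP[z zA ->].
        have [->|zy] := eqVneq z y.
          rewrite -cxy imset_f // !inE xA andbT.
          by move: yA; rewrite !inE eq_sym => /andP[].
        by apply: imset_f; move: zA; rewrite !inE zy => /andP[].
      rewrite (card_in_imset inj) (leq_trans (leq_imset_card _ _)) //.
      have yA' : y \in A by move: yA; rewrite inE => /andP[].
      have := cardsD1 x A; have := cardsD1 y A; rewrite xA yA'; lia.
    rewrite big1 => [|z /andP[/andP[zA zx] zy]]; last first.
      apply/eqP; rewrite eqb0 ?iJ /=; apply/eqP => cz.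
      have : c z \in c @: (A :\ z).
        rewrite cz -cx imset_f // !inE zx //.
      have zAx : z \in A :\ x by rewrite !inE zx.
      case/imsetP => w; rewrite !inE => /andP[wz wA] cw.
      have [wx|wx] := eqVneq w x.
        by move/eqP: zy; apply; apply: inj => //; rewrite cw wx cxy.
      by move/eqP: wz; apply; apply: inj => //; rewrite !inE wx.
    rewrite big1 ?iJ // => j jJ; apply/eqP; rewrite eqb0; apply/eqP => cj.
    have : j \in c @: A.
      rewrite cj !inE eqxx /= andbT; apply: contraNneq jJ => ->; exact: iJ.
    rewrite cAE !inE (negbTE jJ) andbF orbF => /eqP jcx.
    by move: cxJ jJ; rewrite -jcx inE => /andP[_ ->].
  have cxi : c x != i.
    by apply: contra_neq cA => cxi; rewrite cAE cxi setD1K.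
  have cxJ' : c x \notin J by move: cxJ; rewrite !inE cxi.
  rewrite (bigD1 x) //= cx eqxx ?iJ big1 => [|z /andP[zA zx]]; last first.
    apply/eqP; rewrite eqb0; apply: contra cxJ => /eqP <-.
    by rewrite imset_f // !inE eq_sym zx.
  rewrite (bigD1 (c x)) //= cAE big1 => [|j /andP[jJ jcx]]; last first.
    apply/eqP; rewrite eqb0; apply: contra jcx => /eqP/setP/(_ j).
    rewrite !inE (negbTE jJ) andbF !orbF eqxx /= andbT => ->.
    by apply: contraNneq jJ => ->.
  suff -> : c x |: (J :\ i) == (c x |: J) :\ i by [].
  by apply/eqP/setP => k; rewrite !inE; case: eqP => // ->; rewrite cxi.
rewrite negb_exists => /forallP nx.
rewrite big1 => [|x xA]; last first.
  by apply/eqP; rewrite eqb0 ?iJ /=; have := nx x; rewrite xA.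
rewrite add0n big1 // => j jJ; apply/eqP; rewrite eqb0; apply/eqP => cj.
have ij : j != i by apply: contraNneq jJ => ->.
have : j \in c @: A by rewrite cj !inE ij eqxx.
case/imsetP => x xA jx; have := nx x; rewrite xA /= => /eqP; apply.
have inj : {in A &, injective c}.
  apply/imset_injP; rewrite cj cAJ; apply/eqP.
  have := cardsD1 i (j |: J); rewrite cardsU1 jJ !inE iJ orbT; lia.
apply/setP => k; apply/imsetP/idP => [[y]|].
  rewrite !inE => /andP[yx yA] ky; have : k \in c @: A by rewrite ky imset_f.
  rewrite cj !inE => /andP[-> /orP[/eqP kj|->]] //.
  by move/eqP: yx; case; apply: inj => //; rewrite -ky -jx.
rewrite !inE => /andP[ki kJ]; have : k \in c @: A by rewrite cj !inE ki kJ orbT.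
case/imsetP => y yA ky; exists y => //; rewrite !inE yA andbT.
by apply: contraNneq jJ => yx; rewrite jx -yx -ky.
Qed.

(* Count modulo 2 the pairs formed by a room and one of its doors whose colours
   are exactly D minus i: the outside door (set0, [set i]) opens on one room and
   every other door on two, whereas a room that is not fully coloured has an even
   number of doors. *)
Lemma scarf (t0 : T) (i : I) :
  exists A J, [/\ dominant A J, #|A| = #|J| & c @: A = J].
Proof.
have [/existsP[[A J] /and3P[dA /eqP cA /eqP cJ]]|] := boolP
  [exists p : {set T} * {set I},
     [&& dominant p.1 p.2, #|p.1| == #|p.2| & c @: p.1 == p.2]].
  by exists A, J.
rewrite negb_exists => /forallP noroom; exfalso.
pose door A D := [&& #|D| == #|A|.+1, i \in D & c @: A == D :\ i].
pose roomE A J := dominant A J && (#|A| == #|J|).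
pose E := \sum_(A : {set T}) \sum_(D : {set I})
  (\sum_(x | x \notin A) (door A D && roomE (x |: A) D : nat)
  + \sum_(j in D) (door A D && roomE A (D :\ j) : nat)).
have E_odd : odd E.
  have dE A D : door A D ->
      \sum_(x | x \notin A) (door A D && roomE (x |: A) D : nat)
    + \sum_(j in D) (door A D && roomE A (D :\ j) : nat) =
      \sum_(x | x \notin A) (dominant (x |: A) D : nat)
    + \sum_(j in D) (dominant A (D :\ j) : nat).
    move=> dAD; rewrite dAD /=; case/and3P: dAD => /eqP cD iD _.
    congr (_ + _); [apply: eq_bigr => x xA|apply: eq_bigr => j jD];
      congr nat_of_bool.
      by rewrite /roomE cardsU1 xA cD eqxx andbT.
    by rewrite /roomE -eqSS -cD (cardsD1 j D) jD eqxx andbT.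
  have out : door set0 [set i].
    by rewrite /door cards1 cards0 set11 imset0 setDv !eqxx.
  rewrite /E (bigD1 set0) //= (bigD1 [set i]) //= dE // -addnA oddD.
  have -> : odd (\sum_(x | x \notin set0) (dominant (x |: set0) [set i] : nat)
     + \sum_(j in [set i]) (dominant set0 ([set i] :\ j) : nat)).
    rewrite big_set1 setDv addnC; case: (boolP (dominant _ set0)) => [|_].
      by move/dominantP/(_ t0) => [j]; rewrite inE.
    (* The single room behind the outside door consists of the best element for the order [i]. *)
    have [x _ xmax] := arg_maxnP (P := predT) (r i) (erefl (predT t0)).
    rewrite (bigD1 x) ?inE //= big1 => [|y /andP[_ yx]].
      have -> // : dominant (x |: set0) [set i].
      apply/dominantP => t; exists i => [|a]; rewrite !inE // orbF => /eqP ->.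
      exact: xmax.
    apply/eqP; rewrite eqb0; apply: contra_neqN yx => /dominantP/(_ x)[j].
    rewrite inE => /eqP -> /(_ y); rewrite !inE eqxx => /(_ isT) xy.
    by apply: (@r_inj i); apply/eqP; rewrite eqn_leq xy andbT; exact: xmax.
  rewrite addTb oddD negb_add; apply/eqP; transitivity false.
    elim/big_ind: _ => // [a b /negPf|D Di]; first by rewrite oddD => -> ->.
    have [dD|ndD] := boolP (door set0 D).
      case/and3P: dD => cD iD _; move: cD; rewrite cards0 => /cards1P[k Dk].
      by move: iD Di; rewrite Dk inE => /eqP ->; rewrite eqxx.
    by rewrite !big1.
  apply/esym/negbTE.
  elim/big_ind: _ => // [a b /negPf|A A0]; first by rewrite oddD => -> /negPf ->.
  elim/big_ind: _ => // [a b /negPf|D _]; first by rewrite oddD => -> /negPf ->.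
  have [dD|ndD] := boolP (door A D); last by rewrite !big1.
  have [domD|ndomD] := boolP (dominant A D).
    have /set0Pn[a aA] := A0; have := dE _ _ dD; rewrite dD /= => ->.
    by apply: inner_door_even aA domD _; case/and3P: dD => /eqP.
  (* Dominance passes to a smaller [A] and a larger index set, so a door that is not dominant has no
     room beside it. *)
  rewrite !big1 // => [j _|x _]; apply/eqP; rewrite eqb0;
    apply: contra ndomD => /andP[_ /andP[+ _]]; apply: dominant_sub => //.
    exact: subD1set.
  exact: subsetU1.
have : ~~ odd E; last by rewrite E_odd.
(* The same incidences are now grouped by rooms; each group is even, since no room is fully
   coloured. *)
have -> : E = \sum_(A : {set T}) \sum_(J : {set I} | roomE A J)
   (\sum_(x in A) (door (A :\ x) J : nat)
    + \sum_(j | j \notin J) (door A (j |: J) : nat)).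
  rewrite /E; under eq_bigr => A _ do rewrite big_split /=.
  rewrite big_split /=; under [RHS]eq_bigr => A _ do rewrite big_split /=.
  rewrite [RHS]big_split /=; congr (_ + _).
    rewrite exchange_big [RHS](exchange_big_dep predT) //=; apply: eq_bigr => J _.
    rewrite (exchange_setU1_setD1 (fun A B => door A J && roomE B J : nat)).
    rewrite [RHS]big_mkcond; apply: eq_bigr => A _ /=.
    case: (roomE A J); first by apply: eq_bigr => x _; rewrite andbT.
    by rewrite big1 // => x _; rewrite andbF.
  apply: eq_bigr => A _.
  rewrite -(exchange_setU1_setD1 (fun B D => door A D && roomE A B : nat)).
  rewrite [RHS]big_mkcond; apply: eq_bigr => J _ /=.
  case: (roomE A J); first by apply: eq_bigr => x _; rewrite andbT.
  by rewrite big1 // => x _; rewrite andbF.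
elim/big_ind: _ => // [a b /negPf|A _]; first by rewrite oddD => -> /negPf ->.
elim/big_ind: _ => // [a b /negPf|J rAJ]; first by rewrite oddD => -> /negPf ->.
case/andP: rAJ (noroom (A, J)) => /= dA /eqP cA; rewrite dA cA eqxx /= => cJ.
have := uncoloured_room_even i cA cJ.
congr (~~ odd (_ + _)); [apply: eq_bigr => x xA|apply: eq_bigr => j jJ];
  congr nat_of_bool.
  by rewrite /door -cA (cardsD1 x A) xA eqxx.
by rewrite /door cardsU1 jJ cA eqxx.
Qed.

End Scarf.

(** Scarf's lemma is applied to the grid points of sum [N], ordered by each coordinate. Dominance
    forces the minima over [A] of the coordinates in [J] to add up to more than [N - #|J|]. As each
    point has coordinate sum [N], little is left above these minima or outside [J]. *)
Lemma grid_colouring (n N : nat) (c : {ffun 'I_n.+1 -> 'I_N.+1} -> 'I_n.+1) :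
  exists (A : {set {ffun 'I_n.+1 -> 'I_N.+1}}) (J : {set 'I_n.+1}),
  [/\ A != set0, c @: A = J,
      forall a, a \in A -> \sum_i a i = N,
      forall a b i, a \in A -> b \in A -> a i <= b i + n.+1
    & forall a i, a \in A -> i \notin J -> a i <= n.+1].
Proof.
pose T : finType := {t : {ffun 'I_n.+1 -> 'I_N.+1} | \sum_i t i == N}.
pose v (t : T) : {ffun 'I_n.+1 -> 'I_N.+1} := val t.
(* Ties between equal coordinates are broken by the enumeration rank, which is less than [K]. *)
pose K := #|T|; pose r (j : 'I_n.+1) (t : T) := v t j * K + enum_rank t.
have r_inj j : injective (r j).
  move=> s t /(congr1 (modn^~ K)); rewrite !modnMDl !modn_small ?ltn_ord //.
  by move/val_inj/enum_rank_inj.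
have r_lt j s t : v s j < v t j -> r j s < r j t.
  move=> st; apply: (@leq_trans ((v s j).+1 * K)).
    by rewrite /r mulSn addnC ltn_add2r ltn_ord.
  by apply: leq_trans (leq_addr _ _); rewrite leq_mul2r st orbT.
pose t0f := [ffun i : 'I_n.+1 => if i == ord0 then @ord_max N else ord0].
have t0P : \sum_i t0f i == N.
  rewrite (bigD1 ord0) //= ffunE eqxx big1 ?addn0 // => i /negPf i0.
  by rewrite ffunE i0.
pose t0 : T := exist _ t0f t0P.
have [A [J [dA cAJ cJ]]] := scarf r_inj (c \o v) t0 ord0.
have [j0 j0J _] := dominantP _ _ _ dA t0.
have [a0 a0A] : exists a, a \in A.
  by apply/card_gt0P; rewrite cAJ; apply/card_gt0P; exists j0.
pose m j : nat := v [arg min_(a < a0 in A) v a j] j.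
have m_min j a : a \in A -> m j <= v a j.
  by rewrite /m; case: arg_minnP => // b _; apply.
have m_ex j : exists2 a, a \in A & v a j = m j :> nat.
  by rewrite /m; case: arg_minnP => // b bA _; exists b.
have J_le : #|J| <= n.+1 by have := max_card (mem J); rewrite card_ord.
have m_big : N < \sum_(j in J) m j + #|J|.
  rewrite ltnNge; apply/negP => sm.
  pose s := \sum_(j in J) m j + #|J|.
  (* A grid point that exceeds every minimum on [J], with the surplus [N - s] placed on [j0], would
     contradict dominance. *)
  pose u j := if j \in J then (m j).+1 + (if j == j0 then N - s else 0) else 0.
  have su : \sum_j u j = N.
    rewrite -big_mkcond /= big_split /=.
    under eq_bigr => j _ do rewrite -addn1.
    rewrite big_split /= sum1_card -big_mkcondr /=.
    rewrite [X in _ + X](big_pred1 j0) => [|j]; last first.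
      by rewrite /=; case: eqVneq => [->|]; rewrite ?j0J ?andbF.
    by rewrite subnKC.
  have uN j : u j < N.+1 by rewrite ltnS -su (bigD1 j) //= leq_addr.
  pose tf := [ffun j => Ordinal (uN j)].
  have tP : \sum_i tf i == N.
    by rewrite -[X in _ == X]su; apply/eqP/eq_bigr => i _; rewrite ffunE.
  have /dominantP/(_ (exist _ tf tP))[j jJ jt] := dA.
  have [a aA am] := m_ex j; have := jt a aA; rewrite leqNgt => /negP; apply.
  by apply: r_lt; rewrite /= ffunE /= am /u jJ; lia.
have sumA (a : T) : \sum_i v a i = N by apply/eqP/(valP a).
have a_le (a : T) i : a \in A -> i \in J -> v a i <= m i + n.+1.
  move=> aA iJ; have := sumA a; rewrite (bigID (fun j => j \in J)) /= (bigD1 i) //=.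
  move: m_big; rewrite (bigD1 i) //=.
  have : \sum_(j in J | j != i) m j <= \sum_(j in J | j != i) v a j.
    by apply: leq_sum => j _; exact: m_min.
  move: J_le; move: #|J| (\sum_(j in J | j != i) m j) (\sum_(j in J | j != i) v a j).
  move: (\sum_(j < n.+1 | j \notin J) v a j) (m i) (nat_of_ord (v a i)).
  lia.
have a_le' (a : T) i : a \in A -> i \notin J -> v a i <= n.+1.
  move=> aA iJ; have := sumA a; rewrite (bigID (fun j => j \in J)) /= addnC (bigD1 i) //=.
  move: m_big.
  have : \sum_(j in J) m j <= \sum_(j in J) v a j.
    by apply: leq_sum => j _; exact: m_min.
  move: J_le; move: #|J| (\sum_(j in J) m j) (\sum_(j in J) v a j).
  move: (\sum_(j < n.+1 | (j \notin J) && (j != i)) v a j) (nat_of_ord (v a i)).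
  lia.
exists (v @: A), J; split=> [||_ /imsetP[a _ ->]//||_ i /imsetP[a aA ->]].
- by apply/set0Pn; exists (v a0); rewrite imset_f.
- by rewrite -imset_comp.
- move=> _ _ i /imsetP[a aA ->] /imsetP[b bA ->].
  have [iJ|iJ] := boolP (i \in J).
    by apply: leq_trans (a_le _ _ aA iJ) _; rewrite leq_add2r m_min.
  by apply: leq_trans (a_le' _ _ aA iJ) _; rewrite leq_addl.
- exact: a_le'.
Qed.

From mathcomp Require Import all_classical all_reals all_analysis.
From mathcomp Require Import lra ring.

Import Order.TTheory GRing.Theory Num.Theory.
Import numFieldNormedType.Exports.

Local Open Scope classical_set_scope.
Local Open Scope ring_scope.

(** * Brouwer's fixed point theorem *)

Lemma continuous_at_sum (R : numFieldType) (V : normedModType R)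
    (T : topologicalType) (I : Type) (s : seq I) (P : pred I)
    (F : I -> T -> V) (x : T) :
  (forall i, {for x, continuous (F i)}) ->
  {for x, continuous (fun y => \sum_(i <- s | P i) F i y)}.
Proof.
move=> Fc; elim: s => [|i s IHs].
  under [X in {for _, continuous X}]funext do rewrite big_nil.
  exact: cvg_cst.
under [X in {for _, continuous X}]funext do rewrite big_cons.
by case: (P i) => //; apply: cvgD => //; exact: Fc.
Qed.

Section RowVectors.
Context {R : realType} {n : nat}.
Implicit Types x y : 'rV[R]_n.

Lemma norm_coord_le x i : `|x ord0 i| <= `|x|.
Proof.
have /mapP[j Hj ->] : `|x ord0 i| \in [seq `|x y.1 y.2| | y : 'I_1 * 'I_n].
  by apply/mapP; exists (ord0, i) => //=; rewrite mem_enum.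
by rewrite [leRHS]/Num.Def.normr /= mx_normrE; apply/bigmax_geP; right => /=; exists j.
Qed.

Lemma norm_rV_le x (e : R) : 0 <= e -> (forall i, `|x ord0 i| <= e) -> `|x| <= e.
Proof.
move=> e0 xe; rewrite [leLHS]/Num.Def.normr /= mx_normrE; apply/bigmax_leP.
by split => // -[i j] _ /=; rewrite ord1.
Qed.

Lemma continuous_rV (T : topologicalType) (g : T -> 'rV[R]_n) (t : T) :
  (forall i, {for t, continuous (fun s => g s ord0 i)}) -> {for t, continuous g}.
Proof.
move=> gc; apply/cvgrPdist_le => e e0.
have : \forall s \near t, forall i, `|g t ord0 i - g s ord0 i| <= e.
  by apply: filter_forall => i; have /cvgrPdist_le/(_ _ e0) := gc i.
by apply: filterS => s gs; apply: norm_rV_le (ltW e0) _ => i; rewrite !mxE.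
Qed.

End RowVectors.

Section Brouwer.
Variable R : realType.

Definition std_simplex n : set 'rV[R]_n :=
  [set x | (forall i, 0 <= x ord0 i) /\ \sum_i x ord0 i = 1].

Lemma std_simplex_compact n : compact (@std_simplex n).
Proof.
apply: bounded_closed_compact.
  exists 1; split => // M M1 x [x0 x1]; apply: norm_rV_le; first by lra.
  move=> i; rewrite ger0_norm //; apply: le_trans (ltW M1).
  by rewrite -x1 (bigD1 i) //= lerDl sumr_ge0.
have -> : @std_simplex n = \bigcap_i (fun x => x ord0 i) @^-1` [set t : R | 0 <= t]
    `&` (fun x => \sum_i x ord0 i) @^-1` [set 1].
  apply/seteqP; split => x /= [x0 x1]; split => // i; first by move=> _; exact: x0.
  exact: x0.
apply: closedI; last first.
  apply: preimage_closed; last exact: closed_eq.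
  by move=> x _; apply: continuous_at_sum => i; exact: coord_continuous.
apply: closed_bigI => i _; apply: preimage_closed; last exact: closed_ge.
by move=> x _; exact: coord_continuous.
Qed.

Section Simplex.
Variables (n : nat) (phi : 'rV[R]_n.+1 -> 'rV[R]_n.+1).
Hypothesis phi_simplex : forall x, std_simplex x -> std_simplex (phi x).

(* Colour a grid point by a coordinate that phi does not decrease. *)
Let approx_fixpoint (N : nat) : exists2 x, std_simplex x &
  forall j, (exists a, [/\ std_simplex a, a ord0 j <= phi a ord0 j
                         & `|x - a| <= n.+1%:R / N.+1%:R])
            \/ x ord0 j <= n.+1%:R / N.+1%:R.
Proof.
(* The grid points have sum [N.+1] and are rescaled into the simplex, so that the denominator is
   never zero. *)
pose p (t : {ffun 'I_n.+1 -> 'I_N.+2}) : 'rV[R]_n.+1 :=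
  \row_i ((t i)%:R / N.+1%:R).
have N0 : 0 < N.+1%:R :> R by rewrite ltr0n.
have pS (t : {ffun 'I_n.+1 -> 'I_N.+2}) : (\sum_i t i)%N = N.+1 -> std_simplex (p t).
  move=> tN; split => [i|]; first by rewrite mxE divr_ge0.
  under eq_bigr do rewrite mxE.
  by rewrite -mulr_suml -natr_sum tN divff // gt_eqF.
pose c (t : {ffun 'I_n.+1 -> 'I_N.+2}) :=
    odflt ord0 [pick i | p t ord0 i <= phi (p t) ord0 i].
have cP t : std_simplex (p t) -> p t ord0 (c t) <= phi (p t) ord0 (c t).
  rewrite /c; case: pickP => //= np pt; exfalso.
  have [_ s1] := phi_simplex pt; have [_ s2] := pt.
  have : \sum_i phi (p t) ord0 i < \sum_i p t ord0 i.
    apply: ltr_sum; first by apply/hasP; exists ord0; rewrite ?mem_index_enum.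
    by move=> i _; rewrite ltNge np.
  by rewrite s1 s2 ltxx.
have [A [J [/set0Pn[a0 a0A] cA sA dA oA]]] := grid_colouring c.
exists (p a0) => [|j]; first exact/pS/sA.
have [jJ|jJ] := boolP (j \in J); last first.
  by right; rewrite mxE ler_pM2r ?invr_gt0 // ler_nat oA.
left; move: jJ; rewrite -cA => /imsetP[a aA jE]; exists (p a).
have pa := pS _ (sA _ aA); split => //; first by rewrite jE cP.
apply: norm_rV_le => [|i]; first by rewrite divr_ge0.
rewrite !mxE -mulrBl normrM [X in _ * X]ger0_norm ?invr_ge0 //.
rewrite ler_pM2r ?invr_gt0 // ler_norml.
have := dA _ _ i a0A aA; have := dA _ _ i aA a0A.
rewrite -!(ler_nat R) !natrD; lra.
Qed.

(** A cluster point [x] of the approximate fixed points satisfies [x ord0 j <= phi x ord0 j] for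
    every [j]; both sides sum to 1, hence they are equal. *)
Lemma brouwer_simplex :
  (forall x, std_simplex x -> {for x, continuous phi}) ->
  exists2 x, std_simplex x & phi x = x.
Proof.
move=> phi_cont.
have /choice[u uP] : forall N, exists x, std_simplex x /\
  forall j, (exists a, [/\ std_simplex a, a ord0 j <= phi a ord0 j
                         & `|x - a| <= n.+1%:R / N.+1%:R])
            \/ x ord0 j <= n.+1%:R / N.+1%:R.
  by move=> N; have [x] := approx_fixpoint N; exists x.
have [x [xS xcl]] : @std_simplex n.+1 `&` cluster (u @ \oo) !=set0.
  apply: std_simplex_compact.
  by exists 0%N => // N _; have [] := uP N.
have [x0 x1] := xS; have [y0 y1] := phi_simplex xS.
exists x => //.
suff le_phi j : x ord0 j <= phi x ord0 j.
  apply/rowP => j; apply/eqP; rewrite -subr_eq0; apply/eqP.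
  have /psumr_eq0P : \sum_i (phi x ord0 i - x ord0 i) = 0.
    by rewrite sumrB x1 y1 subrr.
  by apply => // i _; rewrite subr_ge0.
rewrite leNgt; apply/negP => lt_phi.
(* The gap [d] cannot close if [x] and [phi x] each move by less than [d / 2], which rules out a
   nearby [a] with [a ord0 j <= phi a ord0 j]. *)
pose d := x ord0 j - phi x ord0 j.
have d0 : 0 < d by rewrite subr_gt0.
have d20 : 0 < d / 2 by rewrite divr_gt0.
have /cvgrPdist_lt/(_ _ d20)/nbhs_ballP[dl /= dl0 dlP] := phi_cont _ xS.
pose e := Num.min dl (d / 2).
have e0 : 0 < e by rewrite lt_min dl0.
have e20 : 0 < e / 2 by rewrite divr_gt0.
have near_small : \forall N \near \oo, n.+1%:R / N.+1%:R < e / 2.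
  near=> N.
  rewrite ltr_pdivrMr // mulrC -ltr_pdivrMr //.
  apply: (@lt_le_trans _ _ N%:R); last by rewrite ler_nat.
  near: N; exact: nbhs_infty_gtr.
have FA : (u @ \oo) [set y | exists2 N, n.+1%:R / N.+1%:R < e / 2 & y = u N].
  by move: near_small; apply: filterS => N hN; exists N.
have [_ [[N hN ->] /= xN]] := xcl _ _ FA (nbhsx_ballx x _ e20).
move: xN; rewrite -ball_normE /= => xN.
have e_d : e <= d / 2 by rewrite ge_min lexx orbT.
have e_dl : e <= dl by rewrite ge_min lexx.
have [_ /(_ j)[[a [aS aphi ua]]|uj]] := uP N.
  have xa : `|x - a| < e.
    rewrite -(subrK (u N) x) -addrA (splitr e).
    by apply: le_lt_trans (ler_normD _ _) (ltrD xN (le_lt_trans ua hN)).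
  have /dlP : ball x dl a by rewrite -ball_normE /=; apply: lt_le_trans xa e_dl.
  move=> /(le_lt_trans (norm_coord_le _ j)); rewrite !mxE ltr_norml.
  have := le_lt_trans (norm_coord_le _ j) xa; rewrite !mxE ltr_norml.
  by move: aphi e_d; rewrite /d; lra.
(* Here the [j]-th coordinate of [u N], hence that of [x], is small, although it is at least [d]
   because [phi x ord0 j >= 0]. *)
have := le_lt_trans (norm_coord_le _ j) xN; rewrite !mxE ltr_norml.
have := x0 j; have := y0 j; move: uj hN e_d; rewrite /d.
by move: (n.+1%:R / N.+1%:R : R) => q; lra.
Unshelve. all: by end_near.
Qed.

End Simplex.

(** The last [n] barycentric coordinates parametrise a region of space through the affine map [z].
    [phi] is [h] read in these coordinates, and its first coordinate takes up the remaining mass. *)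
Theorem brouwer n (h : 'rV[R]_n -> 'rV[R]_n) (M : R) :
  continuous h -> (forall x, `|h x| <= M) -> exists x, h x = x.
Proof.
move=> hc hM; have M0 : 0 <= M by exact: le_trans (normr_ge0 _) (hM 0).
(* This scale keeps every [w x k] between 0 and [n.+1%:R^-1], so that the [n] of them sum to at most
   1; [M + 1] in place of [M] makes it positive. *)
pose L := 2 * (M + 1) * n.+1%:R.
have L0 : 0 < L by rewrite !mulr_gt0 //; lra.
pose z (x : 'rV[R]_n.+1) := \row_i (L * x ord0 (lift ord0 i) - (M + 1)).
pose w x i := (h (z x) ord0 i + (M + 1)) / L.
pose phi x : 'rV[R]_n.+1 := \row_i
  if unlift ord0 i is Some k then w x k else 1 - \sum_k w x k.
have phiS x k : phi x ord0 (lift ord0 k) = w x k by rewrite mxE liftK.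
have phi0 x : phi x ord0 ord0 = 1 - \sum_k w x k by rewrite mxE unlift_none.
have w_ge0 x k : 0 <= w x k.
  rewrite divr_ge0 ?ltW //; have := le_trans (norm_coord_le _ k) (hM (z x)).
  by rewrite ler_norml; lra.
have w_le x k : w x k <= n.+1%:R^-1.
  rewrite ler_pdivrMr // /L mulrC mulfK ?pnatr_eq0 //.
  by have := le_trans (norm_coord_le _ k) (hM (z x)); rewrite ler_norml; lra.
have phi_simplex x : std_simplex x -> std_simplex (phi x).
  move=> _; split => [i|].
    have [k ->|->] := unliftP ord0 i; first by rewrite phiS.
    rewrite phi0 subr_ge0; apply: (@le_trans _ _ (\sum_(k < n) n.+1%:R^-1)).
      exact: ler_sum.
    by rewrite sumr_const card_ord -[leLHS]mulr_natl ler_pdivrMr // mul1r ler_nat.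
  by rewrite big_ord_recl phi0 [X in _ + X](eq_bigr (w x)) ?subrK.
have zc : continuous z.
  move=> x; apply: continuous_rV => i.
  have -> : (fun s => z s ord0 i) = (fun s => L * s ord0 (lift ord0 i) - (M + 1)).
    by apply/funext => s; rewrite mxE.
  apply: continuousB; last exact: cst_continuous.
  by apply: continuousM; [exact: cst_continuous|exact: coord_continuous].
have wc k x : {for x, continuous (w^~ k)}.
  rewrite /w; apply: continuousM; last exact: cst_continuous.
  apply: continuousD; last exact: cst_continuous.
  apply: (@continuous_comp _ _ _ (h \o z) (fun v : 'rV[R]_n => v ord0 k)).
    by apply: continuous_comp; [exact: zc|exact: hc].
  exact: coord_continuous.
have phic x : {for x, continuous phi}.
  apply: continuous_rV => i; have [k ->|->] := unliftP ord0 i.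
    have -> : (fun s => phi s ord0 (lift ord0 k)) = w^~ k by exact/funext.
    exact: wc.
  have -> : (fun s => phi s ord0 ord0) = (fun x => 1 - \sum_k w x k).
    exact/funext.
  apply: continuousB; first exact: cst_continuous.
  by apply: continuous_at_sum => k; exact: wc.
have [x _ xE] := brouwer_simplex phi_simplex (fun x _ => phic x).
exists (z x); apply/rowP => k; rewrite mxE -{2}xE phiS /w.
by rewrite mulrC divfK ?gt_eqF // addrK.
Qed.

End Brouwer.

(** * Convexity and lower semicontinuity *)

Section Convexity.
Variables (R : realType) (E : lmodType R).
Implicit Types (A : set E).

Lemma convex_setP A : @convex_set R E A <->
  forall x y t, A x -> A y -> 0 <= t <= 1 -> A (t *: x + (1 - t) *: y).
Proof.
split=> [cA x y t Ax Ay t01|cA x y t].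
  pose t' := Itv01 (proj1 (andP t01)) (proj2 (andP t01)).
  by have := cA x y t'; rewrite !inE => /(_ Ax Ay).
rewrite !inE => Ax Ay; apply: cA => //.
by apply/andP; split; [exact: ge0|exact: le1].
Qed.

(** Induction on the sequence, splitting off one point at a time. Points of weight zero may lie
    outside [A], as happens with partitions of unity. *)
Lemma convex_sum A (I : Type) (s : seq I) (w : I -> R) (x : I -> E) :
  @convex_set R E A -> (forall i, 0 <= w i) -> (forall i, 0 < w i -> A (x i)) ->
  0 < \sum_(i <- s) w i ->
  A ((\sum_(i <- s) w i)^-1 *: \sum_(i <- s) w i *: x i).
Proof.
move=> /convex_setP cA w0 Ax; elim: s => [|i s IHs]; first by rewrite big_nil ltxx.
rewrite !big_cons; set W := \sum_(j <- s) w j => W0.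
have : 0 <= W by apply: sumr_ge0.
rewrite le_eqVlt => /predU1P[WE|W_gt0].
  move: W0; rewrite -WE addr0 => wi0.
  suff -> : \sum_(j <- s) w j *: x j = 0.
    by rewrite addr0 scalerA mulVf ?gt_eqF // scale1r; exact: Ax.
  have : W == 0 by rewrite -WE.
  rewrite /W; elim: (s) => [|j r IHr]; rewrite ?big_nil // !big_cons.
  rewrite paddr_eq0 ?sumr_ge0 // => /andP[/eqP-> /IHr->].
  by rewrite scale0r addr0.
have := w0 i; rewrite le_eqVlt => /predU1P[wi|wi].
  by rewrite -wi scale0r !add0r; exact: IHs.
have -> : (w i + W)^-1 *: (w i *: x i + \sum_(j <- s) w j *: x j) =
    (w i / (w i + W)) *: x i
    + (1 - w i / (w i + W)) *: (W^-1 *: \sum_(j <- s) w j *: x j).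
  rewrite scalerDr !scalerA mulrC; congr (_ + _ *: _).
  by field; rewrite !gt_eqF.
apply: cA; [exact: Ax|exact: IHs|].
apply/andP; split; first by rewrite divr_ge0 // ltW.
by rewrite ler_pdivrMr // mul1r lerDl ltW.
Qed.

End Convexity.

Section NormedConvexity.
Variables (R : realType) (V : normedModType R).
Implicit Types (A : set V).

Lemma convex_closed_ball (c : V) (e : R) : @convex_set R V [set v | `|v - c| <= e].
Proof.
apply/convex_setP => x y t /= xe ye /andP[t0 t1].
have -> : t *: x + (1 - t) *: y - c = t *: (x - c) + (1 - t) *: (y - c).
  by rewrite !scalerBr addrACA -opprD -scalerDl [t + _]addrC subrK scale1r.
apply: le_trans (ler_normD _ _) _; rewrite !normrZ !ger0_norm ?subr_ge0 //.
have -> : e = t * e + (1 - t) * e by ring.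
by rewrite lerD // ler_wpM2l ?subr_ge0.
Qed.

Lemma convex_open_ball (c : V) (e : R) : @convex_set R V [set v | `|v - c| < e].
Proof.
apply/convex_setP => x y t /= xe ye t01.
set m := Num.max `|x - c| `|y - c|.
have me : m < e by rewrite gt_max xe.
apply: le_lt_trans me; have /convex_setP := @convex_closed_ball c m.
by apply => //=; rewrite le_max lexx ?orbT.
Qed.

Lemma closure_normP A y :
  closure A y <-> forall e, 0 < e -> exists2 z, A z & `|y - z| < e.
Proof.
split=> [Ay e e0|Ay B /nbhs_ballP[e /= e0 eB]].
  have [z [Az]] := Ay _ (nbhsx_ballx y _ e0).
  by rewrite -ball_normE /= => yz; exists z.
have [z Az yz] := Ay _ e0; exists z; split => //.
by apply: eB; rewrite -ball_normE.
Qed.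

Lemma convex_closure A : @convex_set R V A -> @convex_set R V (closure A).
Proof.
move=> /convex_setP cA; apply/convex_setP => x y t /closure_normP Ax.
move=> /closure_normP Ay t01; apply/closure_normP => e e0.
have [x' Ax' xx'] := Ax _ e0; have [y' Ay' yy'] := Ay _ e0.
exists (t *: x' + (1 - t) *: y'); first exact: cA.
rewrite opprD addrACA -!scalerBr.
have /convex_setP := @convex_open_ball 0 e.
by move/(_ (x - x') (y - y') t); rewrite /= !subr0; exact.
Qed.

End NormedConvexity.

(** The metric form of lower semicontinuity on a whole normed space. *)
Definition lsc (R : realType) (X V : normedModType R) (F : X -> set V) :=
  forall x y e, F x y -> 0 < e ->
    \forall x' \near x, exists2 y', F x' y' & `|y - y'| < e.

(** The strict inequality leaves a slack [r - |y - h x|], of which one half pays for moving [y] and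
    the other for moving [h x]. *)
Lemma lsc_ball (R : realType) (X V : normedModType R) (F : X -> set V)
    (h : X -> V) (r : R) :
  lsc F -> continuous h -> lsc (fun x => F x `&` [set y | `|y - h x| < r]).
Proof.
move=> lF hc x y e [Fxy /= yr] e0.
pose d := (r - `|y - h x|) / 2.
have d0 : 0 < d by rewrite divr_gt0 // subr_gt0.
pose m := Num.min e d.
have m0 : 0 < m by rewrite lt_min e0.
have hx : \forall x' \near x, `|h x - h x'| < d.
  by have /cvgrPdist_lt/(_ _ d0) := hc x.
apply: filterS2 (lF _ _ _ Fxy m0) hx => x' [y' Fy' yy'] hx'.
move: yy'; rewrite lt_min => /andP[yy' yd].
exists y' => //; split => //=.
have -> : y' - h x' = (y - h x) + (y' - y) + (h x - h x').
  rewrite [RHS]addrA; congr (_ - _).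
  by rewrite [RHS]addrAC subrK addrC subrK.
apply: le_lt_trans (ler_normD _ _) _.
apply: le_lt_trans (lerD (ler_normD _ _) (lexx _)) _.
by rewrite [`|y' - y|]distrC; move: yd hx'; rewrite /d; lra.
Qed.

(** The values are constrained only over a closed ball: off it the constraint is void nearby, and on
    it the target ball is open. [P] switches the constraint off where it cannot be met. *)
Lemma lsc_localize (R : realType) (X V : normedModType R) (F : X -> set V)
    (P : Prop) (a : X) (r : R) (b : V) (s : R) :
  lsc F -> lsc (fun x => F x `&` [set y | P -> `|x - a| <= r -> `|y - b| < s]).
Proof.
move=> lF x y e [Fxy Gy] e0.
have [[p xa]|npa] := pselect (P /\ `|x - a| <= r).
  have := lsc_ball (r := s) lF (@cst_continuous _ _ b).
  move=> /(_ x y e (conj Fxy (Gy p xa)) e0).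
  by apply: filterS => x' [y' [Fy' yb'] yy']; exists y' => //; split.
have npa' : \forall x' \near x, ~ (P /\ `|x' - a| <= r).
  have [p|np] := pselect P; last by apply: nearW => x' [].
  have xa : 0 < `|x - a| - r by rewrite subr_gt0 ltNge; apply/negP => xa; apply: npa.
  apply/nbhs_ballP; exists (`|x - a| - r) => // x'.
  by rewrite -ball_normE /= => xx' [_]; have := ler_distD x' x a; lra.
apply: filterS2 (lF _ _ _ Fxy e0) npa' => x' [y' Fy' yy'] nx'.
by exists y' => //; split => // p xa'; case: nx'.
Qed.

Lemma small_geometric (R : realType) (c e : R) :
  0 < e -> exists N, forall k, (N <= k)%N -> c * 2^-1 ^+ k < e.
Proof.
move=> e0; have : (fun k => c * 2^-1 ^+ k) @ \oo --> c * 0.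
  apply: cvgM; first exact: cvg_cst.
  by apply: cvg_expr; rewrite ger0_norm //; lra.
rewrite mulr0 => /cvgrPdist_lt/(_ _ e0)[N _ NP]; exists N => k /NP /=.
by rewrite sub0r normrN; apply: le_lt_trans; exact: ler_norm.
Qed.

Section UniformLimit.
Variables (R : realType) (T : topologicalType) (V : completeNormedModType R).

(** Geometric steps make the sequence uniformly Cauchy. The last clause lets the invariance under a
    retraction pass to the limit. *)
Lemma uniform_limit (u : nat -> T -> V) (c : R) :
  (forall k, continuous (u k)) ->
  (forall k x, `|u k.+1 x - u k x| <= c * 2^-1 ^+ k) ->
  exists h, [/\ continuous h, forall k x, `|h x - u k x| <= 2 * c * 2^-1 ^+ k
    & forall x y, (forall k, u k x = u k y) -> h x = h y].
Proof.
move=> uc ud.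
have cauchy_u k m x : `|u (k + m)%N x - u k x| <=
    2 * c * 2^-1 ^+ k - 2 * c * 2^-1 ^+ (k + m).
  elim: m => [|m IHm]; first by rewrite addn0 !subrr normr0.
  rewrite addnS -(subrK (u (k + m)%N x) (u _.+1 x)) -addrA.
  apply: le_trans (ler_normD _ _) _; apply: le_trans (lerD (ud _ _) IHm) _.
  rewrite [_ ^+ _.+1]exprS; lra.
have cb k m x : (k <= m)%N -> `|u m x - u k x| <= 2 * c * 2^-1 ^+ k.
  move=> /subnKC <-; apply: le_trans (cauchy_u _ _ _) _.
  rewrite gerBl mulr_ge0 ?exprn_ge0 // mulr_ge0 //.
  by have := le_trans (normr_ge0 _) (ud 0%N x); rewrite expr0 mulr1.
have cvu x : cvg (u ^~ x @ \oo).
  apply/cauchy_cvgP/cauchy_exP => e e0; have [N NP] := small_geometric (2 * c) e0.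
  exists (u N x); exists N => // m Nm; rewrite -ball_normE /= distrC.
  by apply: le_lt_trans (cb _ _ _ Nm) (NP N _).
pose h x := lim (u ^~ x @ \oo).
have hu k x : `|h x - u k x| <= 2 * c * 2^-1 ^+ k.
  apply/ler_addgt0Pl => e e0.
  have /cvgrPdist_lt/(_ _ e0)[N _ NP] := cvu x.
  pose m := maxn N k; have hm : `|h x - u m x| < e by apply: NP; exact: leq_maxl.
  rewrite -(subrK (u m x) (h x)) -addrA; apply: le_trans (ler_normD _ _) _.
  by apply: lerD (ltW hm) (cb _ _ _ _); exact: leq_maxr.
exists h; split=> // [x|x y uxy]; last first.
  by rewrite /h; rewrite (_ : u ^~ x = u ^~ y) //; exact/funext.
apply/cvgrPdist_lt => e e0.
have e30 : 0 < e / 3 by rewrite divr_gt0.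
have [N /(_ N (leqnn N)) NP] := small_geometric (2 * c) e30.
have /cvgrPdist_lt/(_ _ e30) := uc N x; apply: filterS => y uxy.
have -> : h x - h y = (h x - u N x) + (u N x - u N y) - (h y - u N y).
  by rewrite addrA subrK opprB addrA subrK.
apply: le_lt_trans (ler_normB _ _) _.
apply: le_lt_trans (lerD (ler_normD _ _) (lexx _)) _.
by have := hu N x; have := hu N y; move: NP uxy => /=; lra.
Qed.

End UniformLimit.

(** * Relative interiors of convex sets in finite dimension *)

Section RelativeInterior.
Variables (R : realType) (n : nat).
Implicit Types (S : set 'rV[R]_n).

Lemma mulmx_bounded m (N : 'M[R]_(n, m)) :
  exists2 k : R, 0 < k & forall w : 'rV[R]_n, `|w *m N| <= k * `|w|.
Proof.
pose k := 1 + \sum_(i < n) \sum_(j < m) `|N i j|.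
have k0 : 0 < k by rewrite ltr_pwDl // sumr_ge0 // => i _; exact: sumr_ge0.
exists k => // w; apply: norm_rV_le => [|j]; first by rewrite mulr_ge0 // ltW.
rewrite mxE; apply: le_trans (ler_norm_sum _ _ _) _.
apply: (@le_trans _ _ (\sum_(i < n) `|N i j| * `|w|)).
  by apply: ler_sum => i _; rewrite normrM mulrC ler_wpM2l // norm_coord_le.
rewrite -mulr_suml ler_wpM2r //.
apply: (@le_trans _ _ (\sum_(i < n) \sum_(j < m) `|N i j|)); last by rewrite lerDr.
apply: ler_sum => i _; rewrite (bigD1 j) //= lerDl.
exact: sumr_ge0.
Qed.

(** The row space of [W] is the kernel of the bounded map given by [cokermx W], hence closed. *)
Lemma closure_affine_sub S (W : 'M[R]_n) s0 y :
  (forall s, S s -> (s - s0 <= W)%MS) -> closure S y -> (y - s0 <= W)%MS.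
Proof.
move=> SW /closure_normP Sy; rewrite submxE; apply/negPn/negP => yW.
have [k k0 kP] := mulmx_bounded (cokermx W).
have d0 : 0 < `|(y - s0) *m cokermx W| by rewrite normr_gt0.
have [s Ss ys] := Sy _ (divr_gt0 d0 k0).
have := kP (y - s).
have /eqP sW : (s - s0) *m cokermx W == 0 by rewrite -submxE SW.
have -> : y - s = (y - s0) - (s - s0) by rewrite opprB addrA subrK.
rewrite mulmxBl sW subr0 opprB addrA subrK => h.
by move: ys; rewrite ltr_pdivlMr // mulrC ltNge h.
Qed.

(** Take a largest family in [S] whose differences with [s0] are independent. By maximality these
    differences span all directions of [S], and the barycentre of the simplex formed with [s0] is a
    relative interior point. *)
Lemma relative_interior S s0 : @convex_set R 'rV[R]_n S -> S s0 ->
  exists b (d : R) (W : 'M[R]_n), [/\ S b, 0 < d,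
    forall s, S s -> (s - s0 <= W)%MS
  & forall v, (v - s0 <= W)%MS -> `|v - b| < d -> S v].
Proof.
move=> cS Ss0.
pose free_in m := `[< exists f : 'I_m -> 'rV[R]_n,
  (forall i, S (f i)) /\ row_free (\matrix_i (f i - s0)) >].
have free_in0 : exists m, free_in m.
  exists 0%N; apply/asboolP; exists (fun=> s0); split => //.
  by rewrite /row_free -leqn0 rank_leq_row.
have free_in_le m : free_in m -> (m <= n)%N.
  by move=> /asboolP[f [_ /eqP <-]]; exact: rank_leq_col.
have [m /asboolP[f [Sf Bfree]] m_max] := ex_maxnP free_in0 free_in_le.
set B := \matrix_i (f i - s0) in Bfree.
have SB s : S s -> (s - s0 <= B)%MS.
  move=> Ss; apply/negPn/negP => nsB.
  have : free_in (m + 1)%N.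
    apply/asboolP; exists (fun i => if fintype.split i is inl j then f j else s).
    split=> [i|]; first by case: fintype.split.
    have -> : \matrix_i ((if fintype.split i is inl j then f j else s) - s0)
        = col_mx B (s - s0).
      apply/row_matrixP => i; rewrite rowK.
      case: fintype.splitP => j ij.
        have -> : i = lshift 1 j by apply/val_inj.
        by rewrite rowKu rowK.
      have -> : i = rshift m j by apply/val_inj.
      by rewrite rowKd ord1; apply/rowP => k; rewrite !mxE.
    rewrite /row_free eqn_leq rank_leq_row -addsmxE addn1.
    have : (B < B + (s - s0))%MS.
      by rewrite ltmxE addsmxSl addsmx_sub submx_refl /= nsB.
    by move/rank_ltmx; move/eqP: Bfree => ->.
  by move/m_max; rewrite addn1 ltnn.
pose e : R := m.+1%:R^-1.
have e0 : 0 < e by rewrite invr_gt0.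
have [k k0 kP] := mulmx_bounded (pinvmx B).
pose b := s0 + (const_mx e : 'rV_m) *m B.
have inS (c : 'rV[R]_m) : (forall i, 0 <= c ord0 i) -> \sum_i c ord0 i <= 1 ->
    S (s0 + c *m B).
  move=> c0 c1.
  pose w (o : 'I_m.+1) := if unlift ord0 o is Some i then c ord0 i
                          else 1 - \sum_i c ord0 i.
  pose x (o : 'I_m.+1) := if unlift ord0 o is Some i then f i else s0.
  have sw : \sum_o w o = 1.
    rewrite big_ord_recl [X in _ + X](eq_bigr (fun i => c ord0 i)).
      by rewrite /w unlift_none subrK.
    by move=> i _; rewrite /w liftK.
  have := @convex_sum R 'rV[R]_n S 'I_m.+1 (index_enum _) w x cS.
  rewrite sw invr1 scale1r.
  have -> : \sum_o w o *: x o = s0 + c *m B.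
    rewrite big_ord_recl /w /x unlift_none.
    rewrite [X in _ + X](eq_bigr (fun i => c ord0 i *: f i)); last first.
      by move=> i _; rewrite liftK.
    rewrite mulmx_sum_row; under [in RHS]eq_bigr do rewrite rowK scalerBr.
    by rewrite sumrB -scaler_suml scalerBl scale1r addrAC addrA.
  apply=> // o; rewrite /w /x; case: unlift => [i|] => //.
  by rewrite subr_ge0.
(* Within this radius each coefficient stays within [e * e] of [e = 1 / m.+1]; it is then
   nonnegative, and the sum is at most [m * (e + e * e) <= 1]. *)
exists b, (e * e / k), <<B>>%MS; split.
- apply: inS => [i|]; first by rewrite mxE ltW.
  under eq_bigr do rewrite mxE.
  by rewrite sumr_const card_ord -[leLHS]mulr_natr mulrC ler_pdivrMr // mul1r ler_nat.
- by rewrite !divr_gt0 ?mulr_gt0.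
- by move=> s Ss; rewrite genmxE SB.
- move=> v; rewrite genmxE => /submxP[c vc] vb.
  have vE : v = s0 + c *m B by rewrite -vc addrC subrK.
  rewrite vE; have cE : (v - b) *m pinvmx B = c - const_mx e.
    have -> : v - b = (c - const_mx e) *m B.
      by rewrite vE /b opprD addrACA subrr add0r mulmxBl.
    by rewrite mulmxKp.
  have ce i : `|c ord0 i - e| <= e * e.
    have := le_trans (norm_coord_le ((v - b) *m pinvmx B) i) (kP _).
    rewrite cE !mxE => /le_trans; apply.
    by rewrite mulrC -ler_pdivlMr // ltW.
  have ee : e * e <= e.
    by rewrite ler_piMr ?(ltW e0) // invf_le1 ?ler1n ?ltr0n.
  apply: inS => [i|].
    have := ce i; rewrite ler_norml; lra.
  apply: (@le_trans _ _ (\sum_(i < m) (e + e * e))).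
    by apply: ler_sum => i _; have := ce i; rewrite ler_norml; lra.
  rewrite sumr_const card_ord -[leLHS]mulr_natr.
  have : m.+1%:R * e = 1 by rewrite mulfV.
  by rewrite -natr1; nra.
Qed.

(** Let [b] be a relative interior point and [y] close to it. Replacing [z] by a nearby point of [S]
    and shifting [y] to compensate keeps [y] inside [S], so [v] is a combination of two points of
    [S]. *)
Lemma convex_closure_absorb S (v : 'rV[R]_n) : @convex_set R 'rV[R]_n S -> S !=set0 ->
  (forall b (d : R), S b -> 0 < d -> exists (t : R) (y z : 'rV[R]_n), [/\ 0 < t < 1,
     v = t *: y + (1 - t) *: z, closure S y, closure S z & `|y - b| < d]) ->
  S v.
Proof.
move=> cS [s0 Ss0] vP; have [b [d [W [Sb d0 SW inS]]]] := relative_interior cS Ss0.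
have d20 : 0 < d / 2 by rewrite divr_gt0.
have [t [y [z [/andP[t0 t1] -> Sy Sz yb]]]] := vP b _ Sb d20.
have t10 : 0 < 1 - t by rewrite subr_gt0.
(* With this tolerance the compensating shift [q *: (z - z')] is shorter than [d / 2]. *)
have /closure_normP/(_ (d / 2 * t / (1 - t)))[|z' Sz' zz'] := Sz.
  by rewrite divr_gt0 ?mulr_gt0.
pose q := (1 - t) / t.
have q0 : 0 < q by rewrite divr_gt0.
pose y' := y + q *: (z - z').
have -> : t *: y + (1 - t) *: z = t *: y' + (1 - t) *: z'.
  rewrite /y' scalerDr scalerA -addrA; congr (_ + _).
  have -> : t * q = 1 - t by rewrite /q mulrC divfK // gt_eqF.
  by rewrite scalerBr subrK.
move/convex_setP: (cS); apply => //; last by rewrite !ltW.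
apply: inS.
  have -> : y' - s0 = (y - s0) + q *: ((z - s0) - (z' - s0)).
    by rewrite /y' opprB [z - s0 + _]addrA subrK addrAC.
  apply: addmx_sub; first exact: closure_affine_sub SW Sy.
  apply: scalemx_sub; apply: addmx_sub; first exact: closure_affine_sub SW Sz.
  by rewrite eqmx_opp; exact: SW.
rewrite /y' addrAC; apply: le_lt_trans (ler_normD _ _) _.
rewrite normrZ gtr0_norm // (splitr d) ltrD //.
have -> : d / 2 = q * (d / 2 * t / (1 - t)).
  by rewrite /q; field; rewrite !gt_eqF.
by rewrite ltr_pM2l.
Qed.

End RelativeInterior.

(** * Continuous selections *)

Section Selection.
Variables (R : realType) (X : normedModType R) (V : completeNormedModType R).
Variables (A : set X) (rho : X -> X).
Hypotheses (A_compact : compact A) (rho_continuous : continuous rho).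
Hypotheses (rho_in : forall x, A (rho x)) (rho_id : forall x, A x -> rho x = x).

(** Near each point of [A] one vector stays within [e] of the values of [F]. Finitely many such
    neighbourhoods cover [A]; the vectors are averaged with a partition of unity and the result is
    composed with [rho]. *)
Lemma approximate_selection (F : X -> set V) (e : R) :
  lsc F -> (forall x, A x -> @convex_set R V (F x)) ->
  (forall x, A x -> F x !=set0) -> 0 < e ->
  exists h : X -> V, [/\ continuous h, forall x, h (rho x) = h x
    & forall x, A x -> exists2 y, F x y & `|y - h x| < e].
Proof.
move=> lF cF F0 e0.
have /choice[p pP] : forall x, exists p : V * R, (A x -> 0 < p.2) /\
    forall x', `|x - x'| < p.2 -> exists2 y', F x' y' & `|p.1 - y'| < e.
  move=> x; have [Ax|nAx] := pselect (A x); last first.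
    (* Off [A] the radius 0 makes the second clause vacuous. *)
    by exists (0, 0); split => // x' /=; rewrite ltNge normr_ge0.
  have [y Fxy] := F0 _ Ax; have /nbhs_ballP[r /= r0 rP] := lF _ _ _ Fxy e0.
  exists (y, r); split => // x' xx'; apply: rP.
  by rewrite -ball_normE.
have [s scov] : exists s : seq X,
    forall x, A x -> exists2 i, i \in s & `|i - x| < (p i).2.
  have [fs _ fscov] : finite_subset_cover A (fun x => ball x (p x).2) A.
    move: A_compact; rewrite compact_cover; apply.
      by move=> x Ax; apply: ball_open; have [/(_ Ax)] := pP x.
    by move=> x Ax; exists x => //; apply: ballxx; have [/(_ Ax)] := pP x.
  exists (finmap.enum_fset fs) => x /fscov[i /= si].
  by rewrite -ball_normE /= => ix; exists i.
pose w (i x : X) := Num.max 0 ((p i).2 - `|i - x|).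
have w0 i x : 0 <= w i x by rewrite le_max lexx.
pose W x := \sum_(i <- s) w i x.
pose g x := (W x)^-1 *: \sum_(i <- s) w i x *: (p i).1.
have W_gt0 x : A x -> 0 < W x.
  move=> /scov[i si ix].
  rewrite /W (big_rem i) //= ltr_pwDl ?sumr_ge0 //.
  by rewrite lt_max subr_gt0 ix orbT.
have wc i x : {for x, continuous (w i)}.
  apply: continuous_max; first exact: cst_continuous.
  apply: continuousB; first exact: cst_continuous.
  apply: cvg_norm; apply: continuousB; first exact: cst_continuous.
  exact: cvg_id.
have gc x : A x -> {for x, continuous g}.
  move=> Ax; apply: continuousZ.
    apply: continuousV; first by rewrite gt_eqF // W_gt0.
    by apply: continuous_at_sum => i; exact: wc.
  apply: continuous_at_sum => i.
  by apply: continuousZ; [exact: wc|exact: cst_continuous].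
exists (g \o rho); split=> [x|x|x Ax] /=.
- by apply: continuous_comp; [exact: rho_continuous|exact/gc/rho_in].
- by rewrite (rho_id (rho_in x)).
rewrite rho_id //.
(* Averaging the nearby values [q i] of [F x] with the same weights gives a point of [F x]; the
   error is an average of vectors shorter than [e]. *)
have /choice[q qP] : forall i, exists y, 0 < w i x ->
    F x y /\ `|(p i).1 - y| < e.
  move=> i; have [_ ip] := pP i.
  have [ix|ix] := ltP `|i - x| (p i).2.
    by have [y Fy iy] := ip _ ix; exists y.
  by exists 0; rewrite /w max_l ?ltxx // subr_le0.
exists ((W x)^-1 *: \sum_(i <- s) w i x *: q i).
  apply: (@convex_sum R V) => //; first exact: cF.
    by move=> i /qP[].
  exact: W_gt0.
rewrite /g -scalerBr -sumrB; under eq_bigr do rewrite -scalerBr.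
have := @convex_sum R V [set v | `|v - 0| < e] X s (w ^~ x)
  (fun i => q i - (p i).1) (@convex_open_ball R V 0 e).
rewrite /= subr0; apply => // [i /qP[_]|]; last exact: W_gt0.
by rewrite distrC subr0.
Qed.

(** Successive approximation: the next map is an approximate selection of [F] cut down to the ball
    of radius [2^-1 ^+ k] around the current one. The limit is only known to lie in the closure. *)
Lemma closure_selection (F : X -> set V) :
  lsc F -> (forall x, A x -> @convex_set R V (F x)) ->
  (forall x, A x -> F x !=set0) ->
  exists h : X -> V, [/\ continuous h, forall x, h (rho x) = h x
    & forall x, A x -> closure (F x) (h x)].
Proof.
move=> lF cF F0.
pose good k (h : X -> V) := [/\ continuous h, forall x, h (rho x) = h x
  & forall x, A x -> exists2 y, F x y & `|y - h x| < 2^-1 ^+ k].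
have half0 k : 0 < 2^-1 ^+ k :> R by rewrite exprn_gt0.
have [h0 h0P] : exists h0, good 0%N h0.
  exact: approximate_selection lF cF F0 (half0 0%N).
have /choice[next nextP] : forall kh : nat * (X -> V), exists h', good kh.1 kh.2 ->
    good kh.1.+1 h' /\ forall x, `|h' x - kh.2 x| <= 2 * 2^-1 ^+ kh.1.
  case=> k h /=; have [[hc hr hF]|ngood] := pselect (good k h); last by exists h.
  have [||h' [h'c h'r h'F]] := approximate_selection (lsc_ball (r := 2^-1 ^+ k) lF hc)
      _ _ (half0 k.+1).
  - move=> x Ax; have /convex_setP cFx := cF _ Ax.
    have /convex_setP cB := @convex_open_ball R V (h x) (2^-1 ^+ k).
    apply/convex_setP => y z t [Fy By] [Fz Bz] t01.
    by split; [exact: cFx|exact: cB].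
  - by move=> x /hF[y Fy yh]; exists y.
  exists h' => _; split.
    by split => // x /h'F[y [Fy _] yh]; exists y.
  move=> x; rewrite -hr -h'r; have [y [Fy /= yh] yh'] := h'F _ (rho_in x).
  rewrite -(subrK y (h' _)) -addrA; apply: le_trans (ler_normD _ _) _.
  rewrite distrC; move: yh yh'; rewrite exprS.
  by have := half0 k; lra.
pose u := fix u k := if k is k'.+1 then next (k', u k') else h0.
have uP k : good k (u k).
  by elim: k => //= k /(nextP (k, u k))[].
have [||h [hc hu hr]] := @uniform_limit R X V u 2.
- by move=> k; have [] := uP k.
- by move=> k x; have [_ /(_ x)] := nextP (k, u k) (uP k).
exists h; split=> // [x|x Ax]; first by apply: hr => k; have [_] := uP k.
apply/closure_normP => e e0; have e20 : 0 < e / 2 by rewrite divr_gt0.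
have [k /(_ k (leqnn k)) kP] := small_geometric (2 * 2) e20.
have [_ _ /(_ _ Ax)[y Fy yu]] := uP k; exists y => //.
rewrite -(subrK (u k x) (h x)) -addrA; apply: le_lt_trans (ler_normD _ _) _.
rewrite [`|u k x - y|]distrC; have := hu k x; have := half0 k; lra.
Qed.

End Selection.

(* This join of the normed and complete structures is missing in the library. *)
HB.instance Definition _ (K : realType) (m n : nat) := Complete.on 'M[K]_(m, n).

Lemma rational_rV_dense (R : realType) n (v : 'rV[R]_n) (e : R) : 0 < e ->
  exists q : 'rV[rat]_n, `|v - map_mx ratr q| < e.
Proof.
move=> e0; have e20 : 0 < e / 2 by rewrite divr_gt0.
have /choice[q qP] : forall i, exists q : rat, `|v ord0 i - ratr q| <= e / 2.
  move=> i; have [|q] := @rat_in_itvoo R (v ord0 i) (v ord0 i + e / 2).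
    by rewrite ltrDl.
  by rewrite in_itv /= => /andP[q1 q2]; exists q; rewrite ler_norml; lra.
exists (\row_i q i); apply: (@le_lt_trans _ _ (e / 2)); last by lra.
by apply: norm_rV_le => [|i]; [exact: ltW|rewrite !mxE].
Qed.

Lemma small_invS (R : realType) (e : R) : 0 < e -> exists k, k.+1%:R^-1 < e.
Proof.
move=> e0; exists (Num.bound e^-1); rewrite invf_plt ?posrE ?ltr0n //.
by apply: lt_trans (archi_boundP _) _; rewrite ?ltr_nat ?invr_ge0 ?ltW.
Qed.

(** * Selections of maps whose values need not be closed *)

Section ExactSelection.
Variables (R : realType) (p n : nat) (A : set 'rV[R]_p) (rho : 'rV[R]_p -> 'rV[R]_p).
Hypotheses (A_compact : compact A) (rho_continuous : continuous rho).
Hypotheses (rho_in : forall x, A (rho x)) (rho_id : forall x, A x -> rho x = x).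
Variables (F : 'rV[R]_p -> set 'rV[R]_n) (M : R).
Hypotheses (F_lsc : lsc F) (F_convex : forall x, @convex_set R 'rV[R]_n (F x)).
Hypotheses (F_nonempty : forall x, A x -> F x !=set0).
Hypothesis F_bounded : forall x y, F x y -> `|y| <= M.

(* For rational a and b, impose values close to b near a whenever F allows it. *)
Lemma dense_selections : exists f : nat -> 'rV[R]_p -> 'rV[R]_n,
  [/\ forall i, continuous (f i), forall i x, f i (rho x) = f i x,
      forall i x, A x -> closure (F x) (f i x)
    & forall x y e, A x -> F x y -> 0 < e -> exists i, `|f i x - y| < e].
Proof.
pose idx : countType := ('rV[rat]_p * nat * 'rV[rat]_n * nat)%type.
pose rv m (q : 'rV[rat]_m) : 'rV[R]_m := map_mx ratr q.
pose dom (j : idx) := [set x | `|x - rv _ j.1.1.1| <= j.1.1.2.+1%:R^-1].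
pose tgt (j : idx) := [set y | `|y - rv _ j.1.2| < j.2.+1%:R^-1].
(* Imposing the constraint only under this condition keeps the values of [G] nonempty. *)
pose meets j := forall x, A x -> dom j x -> F x `&` tgt j !=set0.
pose G j x := F x `&` [set y | meets j -> dom j x -> tgt j y].
have /choice[f fP] : forall j : idx, exists f, [/\ continuous f,
    forall x, f (rho x) = f x & forall x, A x -> closure (G j x) (f x)].
  move=> j; apply: closure_selection => //.
  - exact: lsc_localize.
  - move=> x _; have /convex_setP cF := @F_convex x; apply/convex_setP.
    move=> y z t [Fy Gy] [Fz Gz] t01; split; first exact: cF.
    move=> mj dx; have /convex_setP := @convex_open_ball R _ (rv _ j.1.2) j.2.+1%:R^-1.
    by apply => //; [exact: Gy|exact: Gz].
  - move=> x Ax; have [[mj dx]|nmd] := pselect (meets j /\ dom j x).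
      by have [y [Fy ty]] := mj x Ax dx; exists y; split.
    by have [y Fy] := F_nonempty Ax; exists y; split => // mj dx; case: nmd.
pose j0 : idx := (0, 0%N, 0, 0%N).
pose g i := f (odflt j0 (unpickle i)).
have GF j x : G j x `<=` F x by move=> y [].
exists g; split => [i|i x|i x Ax|x y e Ax Fxy e0].
- by have [] := fP (odflt j0 (unpickle i)).
- by have [_ gr _] := fP (odflt j0 (unpickle i)); exact: gr.
- by have [_ _ /(_ _ Ax)] := fP (odflt j0 (unpickle i)); apply: closureS.
have [k kP] := small_invS (divr_gt0 e0 (ltr0Sn R 3)).
(* If [b] and a nearby value of [F] are both within [d] of [y], they are within [k.+1%:R^-1] of each
   other, so the target ball around [b] is met. *)
pose d : R := k.+1%:R^-1 / 2.
have k0 : 0 < k.+1%:R^-1 :> R by rewrite invr_gt0.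
have d0 : 0 < d by rewrite divr_gt0.
have [b yb] := rational_rV_dense y d0.
have /nbhs_ballP[r /= r0 rP] := F_lsc Fxy d0.
have [m mP] := small_invS (divr_gt0 r0 (ltr0Sn R 1)).
have m0 : 0 < m.+1%:R^-1 :> R by rewrite invr_gt0.
have [a xa] := rational_rV_dense x m0.
pose j : idx := (a, m, b, k).
have mj : meets j.
  move=> x' Ax' dx'.
  have /rP[y' Fy' yy'] : ball x r x'.
    rewrite -ball_normE /=; have := ler_distD (rv _ a) x x'.
    move: dx'; rewrite /dom /= [`|x' - _|]distrC; move: xa mP.
    by rewrite -/(rv _ a); move: (m.+1%:R^-1 : R) => im; lra.
  exists y'; split => //; rewrite /tgt /=.
  have := ler_distD y y' (rv _ b); rewrite [`|y' - y|]distrC.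
  move: yb yy'; rewrite /d -/(rv _ b).
  by move: (k.+1%:R^-1 : R) => ik; lra.
have dx : dom j x by rewrite /dom /= ltW.
exists (pickle j); rewrite /g pickleK /=.
have [_ _ /(_ _ Ax)/closure_normP/(_ (e / 4))[|z [Fz /(_ mj dx) tz] fz]] := fP j.
  by rewrite divr_gt0.
have := ler_distD z (f j x) y; have := ler_distD (rv _ b) z y.
move: tz; rewrite /tgt /= [`|rv _ b - y|]distrC.
move: fz yb kP k0; rewrite /d -/(rv _ b).
by move: (k.+1%:R^-1 : R) => ik; lra.
Qed.

(** Average the dense selections with weights [2^-1 ^+ i.+1]. Some [f i x] is close to any
    prescribed point of [F x] and has positive weight, while the rest of the average lies in the
    closure; [convex_closure_absorb] then applies. *)
Lemma exact_selection : exists h : 'rV[R]_p -> 'rV[R]_n,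
  [/\ continuous h, forall x, h (rho x) = h x & forall x, A x -> F x (h x)].
Proof.
have [f [fc fr fcl fd]] := dense_selections.
have fM i x : `|f i x| <= M.
  rewrite -fr; apply/ler_addgt0Pl => e e0.
  have /closure_normP/(_ _ e0)[y Fy fy] := fcl i _ (rho_in x).
  have := ler_distD y (f i (rho x)) 0; rewrite !subr0.
  by have := F_bounded Fy; lra.
(* The weight left over after [k] terms goes to [f 0], so that every partial average has total
   weight 1. *)
pose w k j : R := if (j < k)%N then 2^-1 ^+ j.+1 else 2^-1 ^+ k.
pose g k j := if (j < k)%N then f j else f 0%N.
pose u k x := \sum_(j < k.+1) w k j *: g k j x.
have half0 k : 0 < 2^-1 ^+ k :> R by rewrite exprn_gt0.
have uE k x : u k x = \sum_(j < k) 2^-1 ^+ j.+1 *: f j x + 2^-1 ^+ k *: f 0%N x.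
  rewrite /u big_ord_recr /= {2}/w {2}/g ltnn; congr (_ + _).
  by apply: eq_bigr => j _; rewrite /w /g ltn_ord.
have w1 k : \sum_(j < k.+1) w k j = 1.
  rewrite big_ord_recr /= {2}/w ltnn.
  under eq_bigr => j _ do rewrite /w ltn_ord.
  elim: k => [|k IHk]; first by rewrite big_ord0 add0r expr0.
  by rewrite big_ord_recr /= -[RHS]IHk -addrA; congr (_ + _); rewrite exprS; lra.
have [||h [hc hu hr]] := @uniform_limit R _ _ u M.
- move=> k x; apply: continuous_at_sum => j; apply: continuousZ.
    exact: cst_continuous.
  by rewrite /g; case: ifP => _; exact: fc.
- move=> k x; rewrite !uE big_ord_recr /=.
  have -> : forall a b c d : 'rV[R]_n, a + b + c - (a + d) = b + c - d.
    by move=> a b c d; rewrite opprD addrA -[a + b + c]addrA [a + _]addrC addrK.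
  have -> : 2^-1 ^+ k *: f 0%N x = 2^-1 ^+ k.+1 *: f 0%N x + 2^-1 ^+ k.+1 *: f 0%N x.
    by rewrite -scalerDl; congr (_ *: _); rewrite exprS; lra.
  rewrite addrKA; apply: le_trans (ler_normB _ _) _.
  rewrite !normrZ !gtr0_norm // exprS.
  have := half0 k; have := fM k x; have := fM 0%N x; nra.
exists h; split=> // [x|x Ax].
  by apply: hr => k; apply: eq_bigr => j _; rewrite /g; case: ifP => _; rewrite fr.
apply: convex_closure_absorb (@F_convex x) (F_nonempty Ax) _ => b d Fb d0.
have [i id] := fd x b d Ax Fb d0.
pose t : R := 2^-1 ^+ i.+1.
have t0 : 0 < t by exact: half0.
have t1 : t < 1.
  by rewrite /t exprn_ilt1 //; lra.
exists t, (f i x), ((1 - t)^-1 *: (h x - t *: f i x)); split => //.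
- by rewrite t0.
- have t10 : 1 - t != 0 by rewrite subr_eq0 gt_eqF.
  by rewrite scalerA divff // scale1r addrC subrK.
- exact: fcl.
apply/closure_normP => e e0; have e20 : 0 < e / 2 by rewrite divr_gt0.
have t10 : 0 < 1 - t by rewrite subr_gt0.
have [N NP] := small_geometric (2 * M) (mulr_gt0 e20 t10).
(* So large that [f i] already carries its own weight [t] in [u k], and that [u k x] is close enough
   to [h x] even after division by [1 - t]. *)
pose k := maxn N i.+1; have ik : (i < k)%N := leq_maxr _ _.
pose i' : 'I_k.+1 := Ordinal (leqW ik).
have wi : w k i = t by rewrite /w ik.
pose z := (1 - t)^-1 *: (u k x - t *: f i x).
have zF : closure (F x) z.
  have := @convex_sum R _ _ 'I_k.+1 [seq j <- index_enum _ | j != i'] (w k)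
    (fun j => g k j x) (convex_closure (@F_convex x)).
  rewrite !big_filter.
  have -> : \sum_(j | j != i') w k j = 1 - t.
    by rewrite -[in RHS](w1 k) [in RHS](bigD1 i') //= wi [RHS]addrC addKr.
  have -> : \sum_(j | j != i') w k j *: g k j x = u k x - t *: f i x.
    by rewrite /u [in RHS](bigD1 i') //= wi {2}/g ik [RHS]addrC addKr.
  apply=> //; first by move=> j; rewrite /w; case: ifP => _; exact/ltW.
  by move=> j _; rewrite /g; case: ifP => _; exact: fcl.
have /closure_normP/(_ _ e20)[s Fs zs] := zF; exists s => //.
set v := (X in `|X - s|); have vz : `|v - z| < e / 2.
  rewrite /v /z -scalerBr opprB addrA subrK normrZ gtr0_norm ?invr_gt0 //.
  rewrite mulrC ltr_pdivrMr //; apply: le_lt_trans (hu k x) _.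
  by apply: NP; exact: leq_maxl.
by have := ler_distD z v s; lra.
Qed.

End ExactSelection.

(** Brouwer's theorem is applied to an exact selection over a ball containing all values. Invariance
    under the radial retraction bounds it everywhere, and its fixed point lies in the ball, where it
    does select from [F]. *)
Theorem lsc_fixpoint (R : realType) n (F : 'rV[R]_n -> set 'rV[R]_n) (M : R) :
  lsc F -> (forall x, @convex_set R 'rV[R]_n (F x)) -> (forall x, F x !=set0) ->
  (forall x y, F x y -> `|y| <= M) -> exists x, F x x.
Proof.
move=> lF cF F0 FM.
have M0 : 0 <= M by have [y /FM] := F0 0; apply: le_trans.
pose c := M + 1; have c0 : 0 < c by rewrite ltr_wpDl.
pose A := [set x : 'rV[R]_n | `|x| <= c].
have A_compact : compact A.
  apply: bounded_closed_compact.
    exists c; split; first exact: num_real.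
    by move=> d cd x /le_trans; apply; exact: ltW.
  rewrite (_ : A = (fun x => `|x|) @^-1` [set y : R | y <= c]) //.
  apply: preimage_closed; last exact: closed_le.
  by move=> x _; exact: norm_continuous.
pose q (x : 'rV[R]_n) := Num.max c `|x|.
have q0 x : 0 < q x by rewrite lt_max c0.
pose rho x := (c / q x) *: x.
have rho_continuous x : {for x, continuous rho}.
  rewrite /rho; apply: continuousZ; last exact: cvg_id.
  apply: continuousM; first exact: cst_continuous.
  apply: continuousV; first by rewrite gt_eqF.
  by apply: continuous_max; [exact: cst_continuous|exact: norm_continuous].
have rho_in x : A (rho x).
  rewrite /A /= /rho normrZ gtr0_norm ?divr_gt0 // mulrAC ler_pdivrMr //.
  by rewrite ler_pM2l // le_max lexx orbT.
have rho_id x : A x -> rho x = x.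
  by move=> Ax; rewrite /rho /q max_l // divff ?scale1r // gt_eqF.
have [h [hc hr hF]] := @exact_selection R n n A rho A_compact rho_continuous
  rho_in rho_id F M lF cF (fun x _ => F0 x) FM.
have hM x : `|h x| <= M by rewrite -hr; apply/FM/hF.
have [x hx] := brouwer hc hM; exists x; rewrite -{2}hx; apply: hF.
by rewrite /A /= -hx (le_trans (hM _)) // lerDl.
Qed.

(** * Projected solutions *)

(** If this failed, points of [D] converging to [x0] whose values avoid the [e]-ball around [y0]
    would form a net indexed by [nat], and a net of values converging to [y0] along a subnet
    contradicts this. *)
Lemma lower_semicontinuous_near (R : realType) (X V : normedModType R)
    (D : set X) (Phi : X -> set V) x0 y0 (e : R) :
  lower_semicontinuous_on D Phi -> D x0 -> Phi x0 y0 -> 0 < e ->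
  \forall x \near x0, D x -> exists2 y, Phi x y & `|y0 - y| < e.
Proof.
move=> lPhi Dx0 Py0 e0; apply: contrapT => nP.
have /choice[x xP] : forall k, exists x, [/\ `|x0 - x| < k.+1%:R^-1, D x
    & ~ exists2 y, Phi x y & `|y0 - y| < e].
  move=> k; apply: contrapT => nx; apply: nP; apply/nbhs_ballP.
  exists k.+1%:R^-1 => [|x]; first by rewrite /= invr_gt0.
  rewrite -ball_normE /= => xk Dx; apply: contrapT => ny; apply: nx.
  by exists x.
have [|||J [leJ [phi [y [dJ _ yy0 Py]]]]] :=
  lPhi x0 nat (fun i j => (i <= j)%N) x y0 Dx0 _ _ _ Py0.
- split; [exact: inhabits 0%N|by []|by move=> i j k /leq_trans; apply|].
  by move=> i j; exists (maxn i j); split; [exact: leq_maxl|exact: leq_maxr].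
- by move=> i; have [] := xP i.
- move=> A /nbhs_ballP[r /= r0 rA]; have [k kr] := small_invS r0.
  exists k => i ki; apply: rA; rewrite -ball_normE /=; have [xi _ _] := xP i.
  apply: lt_trans xi _; apply: le_lt_trans kr.
  by rewrite lef_pV2 ?posrE ?ltr0n // ler_nat.
- have [j0 /(_ j0 (directed_refl dJ j0)) yj0] := yy0 _ (nbhsx_ballx y0 _ e0).
  have [_ _ []] := xP (phi j0); exists (y j0) => //.
  by move: yj0; rewrite -ball_normE.
Qed.

Lemma continuous_at_norm (R : realType) (X V : normedModType R) (g : X -> V) x :
  (forall e, 0 < e -> \forall y \near x, `|g x - g y| < e) ->
  {for x, continuous g}.
Proof. by move=> gx; apply/cvgrPdist_lt => e /gx. Qed.

(** The parallelogram identity at the midpoint of [x] and [y]. *)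
Lemma proj_uniq (R : realType) n (C : set 'rV[R]_n) z x y :
  @convex_set R 'rV[R]_n C -> Defs.proj C z x -> Defs.proj C z y -> x = y.
Proof.
move=> /convex_setP cC [Cx xmin] [Cy ymin].
pose m := 2^-1 *: x + (1 - 2^-1) *: y.
have Cm : C m by apply: cC => //; lra.
pose N (v : 'rV[R]_n) := \sum_i v ord0 i ^+ 2.
have N0 v : 0 <= N v by apply: sumr_ge0 => i _; exact: sqr_ge0.
have := xmin _ Cm; have := ymin _ Cm; rewrite /enorm !ler_sqrt ?N0 // => ym xm.
have E : N (z - m) = 2^-1 * N (z - x) + 2^-1 * N (z - y) - 4^-1 * N (x - y).
  rewrite /N !mulr_sumr -!big_split /= -sumrB; apply: eq_bigr => i _.
  by rewrite !mxE; field.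
have /psumr_eq0P xy0 : N (x - y) = 0.
  by apply/eqP; rewrite eq_le N0 andbT; move: ym xm E; rewrite -!/(N _); lra.
apply/rowP => i; apply/eqP; rewrite -subr_eq0 -sqrf_eq0; apply/eqP.
by have := xy0 (fun i _ => sqr_ge0 _) i isT; rewrite !mxE.
Qed.

(** * Convex hulls and finite families *)

Section ConvexHull.
Variables (R : realType) (E : lmodType R).
Implicit Types A B : set E.

Lemma convex_hull_sub A B : @convex_set R E B -> A `<=` B -> convex_hull A `<=` B.
Proof. by move=> cB AB; apply: smallest_sub. Qed.

Lemma sub_convex_hull A : A `<=` convex_hull A.
Proof. exact: sub_smallest. Qed.

Lemma convex_hull_convex A : @convex_set R E (convex_hull A).
Proof.
apply/convex_setP => x y t Ax Ay t01 B [cB AB].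
by move/convex_setP: (cB); apply => //; [exact: Ax|exact: Ay].
Qed.

End ConvexHull.

Section FiniteHull.
Variables (R : realType) (E : lmodType R).
Implicit Types A : set E.

(** This is again the convex hull of [A], presented through finite families: these can be perturbed
    point by point and match proper quasimonotonicity. *)
Definition finite_hull A : set E :=
  [set y | exists m (x : 'I_m -> E), (forall i, A (x i)) /\ convex_hull (range x) y].

Lemma finite_hull_convex A : @convex_set R E (finite_hull A).
Proof.
apply/convex_setP => y z t [m [x [Ax hy]]] [k [x' [Ax' hz]]] t01.
pose w (i : 'I_(m + k)) := match fintype.split i with inl j => x j | inr j => x' j end.
exists (m + k)%N, w; split; first by move=> i; rewrite /w; case: fintype.split.
have /convex_setP := @convex_hull_convex R E (range w); apply => //.
  apply: convex_hull_sub hy; first exact: convex_hull_convex.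
  move=> _ [i _ <-]; apply: sub_convex_hull; exists (lshift k i) => //.
  by rewrite /w (unsplitK (inl i)).
apply: convex_hull_sub hz; first exact: convex_hull_convex.
move=> _ [i _ <-]; apply: sub_convex_hull; exists (rshift m i) => //.
by rewrite /w (unsplitK (inr i)).
Qed.

Lemma finite_hull_nonempty A : A !=set0 -> finite_hull A !=set0.
Proof.
case=> y Ay; exists y, 1%N, (fun=> y); split => //.
by apply: sub_convex_hull; exists ord0.
Qed.

Lemma finite_hull_sub A B : @convex_set R E B -> A `<=` B -> finite_hull A `<=` B.
Proof.
move=> cB AB y [m [x [Ax]]]; apply: convex_hull_sub => //.
by move=> _ [i _ <-]; exact/AB/Ax.
Qed.

End FiniteHull.

(** The points at distance less than [e] from the hull of [x'] form a convex set containing every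
    [x i]. *)
Lemma convex_hull_near (R : realType) (V : normedModType R) m (x x' : 'I_m -> V) y e :
  (forall i, `|x i - x' i| < e) -> convex_hull (range x) y ->
  exists2 y', convex_hull (range x') y' & `|y - y'| < e.
Proof.
move=> xx'; apply: (@convex_hull_sub _ _ _
  [set y | exists2 y', convex_hull (range x') y' & `|y - y'| < e]).
  apply/convex_setP => a b t [a' ha aa'] [b' hb bb'] t01.
  exists (t *: a' + (1 - t) *: b').
    by have /convex_setP := @convex_hull_convex R V (range x'); apply.
  have -> : t *: a + (1 - t) *: b - (t *: a' + (1 - t) *: b') =
      t *: (a - a') + (1 - t) *: (b - b') by rewrite !scalerBr opprD addrACA.
  have /convex_setP := @convex_open_ball R V 0 e.
  by move/(_ (a - a') (b - b') t); rewrite /= !subr0; apply.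
move=> _ [i _ <-]; exists (x' i) => //.
by apply: sub_convex_hull; exists i.
Qed.

Theorem theorem4p5 (R : realType) (n : nat) (C : set 'rV[R]_n)
    (K : 'rV[R]_n -> set 'rV[R]_n) (f : 'rV[R]_n -> 'rV[R]_n -> R)
    (C_nonempty : C !=set0) (C_compact : compact C)
    (C_convex : @convex_set R 'rV[R]_n C)
    (Q_lsc : lower_semicontinuous_on (C `*` setT) (Qmap C K))
    (Q_nonempty : forall p, (C `*` setT) p -> Qmap C K p !=set0)
    (Q_convex : forall p, (C `*` setT) p ->
      @convex_set R ('rV[R]_n * 'rV[R]_n)%type (Qmap C K p))
    (Q_relcompact : precompact (image_on (C `*` setT) (Qmap C K)))
    (FixQ_closed : closed (Fix_on (C `*` setT) (Qmap C K)))
    (G_lsc : lower_semicontinuous_on (Fix_on (C `*` setT) (Qmap C K)) (Gmap K f))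
    (f_pqm : properly_quasimonotone f (convex_hull (image_on C K))) :
  minty_projected_solutions C K f !=set0 /\
  (upper_sign_property f setT \/ pseudomonotone (fun x y => - f x y) setT ->
   projected_solutions C K f !=set0).
Proof.
have [c0 Cc0] := C_nonempty.
(* Projections exist because the values of [Q] are nonempty. *)
have /choice[p pP] : forall z, exists x, Defs.proj C z x.
  by move=> z; have [[x y] []] := Q_nonempty (c0, z) (conj Cc0 I); exists x.
have pC z : C (p z) by have [] := pP z.
have K_nonempty x : C x -> K x !=set0.
  by move=> Cx; have [[a y] []] := Q_nonempty (x, 0) (conj Cx I); exists y.
have K_convex x : C x -> @convex_set R 'rV[R]_n (K x).
  move=> Cx; apply/convex_setP => y z t Ky Kz t01.
  have /convex_setP cQ := Q_convex (x, 0) (conj Cx I).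
  by have [] := cQ (p 0, y) (p 0, z) t (conj (pP 0) Ky) (conj (pP 0) Kz) t01.
have [M KM] : exists M, forall x y, C x -> K x y -> `|y| <= M.
  move: Q_relcompact; rewrite precompactE => /compact_bounded[M [_ MP]].
  exists (M + 1) => x y Cx Kxy.
  have := MP (M + 1) _ (p 0, y); rewrite ltrDl => /(_ ltr01).
  have Qy : closure (image_on (C `*` setT) (Qmap C K)) (p 0, y).
    by apply: subset_closure; exists (x, 0) => //; split => //; exact: pP.
  by move=> /(_ Qy); apply: le_trans; rewrite prod_normE /= le_max lexx orbT.
(* Lower semicontinuity of [Q] gives a point of [proj C z'] near [p z], and by uniqueness this point
   is [p z']. *)
have p_continuous z : {for z, continuous p}.
  apply: continuous_at_norm => e e0; have [y Ky] := K_nonempty _ (pC z).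
  have /nbhs_ballP[r /= r0 rP] := @lower_semicontinuous_near R _ _ _ _ (p z, z)
    (p z, y) e Q_lsc (conj (pC z) I) (conj (pP z) Ky) e0.
  apply/nbhs_ballP; exists r => // z' zz'.
  have /rP/(_ (conj (pC z) I))[[a b] [/= pa _]] : ball (p z, z) r (p z, z').
    by split => //=; exact: ballxx.
  rewrite (proj_uniq C_convex (pP z') pa); apply: le_lt_trans.
  by rewrite prod_normE /= le_max lexx.
pose pz z := (p z, z).
have pz_near z (P : 'rV[R]_n * 'rV[R]_n -> Prop) :
    (\forall q \near pz z, P q) -> \forall z' \near z, P (pz z').
  move=> /nbhs_ballP[r /= r0 rP].
  have /cvgrPdist_lt/(_ _ r0)/nbhs_ballP[s /= s0 sP] := p_continuous z.
  apply/nbhs_ballP; exists (Num.min r s) => [|z']; first by rewrite /= lt_min r0.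
  rewrite -ball_normE /= lt_min => /andP[zr zs]; apply: rP.
  by split; rewrite -ball_normE //=; apply: sP; rewrite -ball_normE.
have K_lsc z y e : K (p z) y -> 0 < e ->
    \forall z' \near z, exists2 y', K (p z') y' & `|y - y'| < e.
  move=> Ky e0; have := @lower_semicontinuous_near R _ _ _ _ (pz z) (p z, y) e
    Q_lsc (conj (pC z) I) (conj (pP z) Ky) e0.
  move/pz_near; apply: filterS => z' /(_ (conj (pC z') I))[[a b] [/= _ Kb]] yb.
  exists b => //; apply: le_lt_trans yb.
  by rewrite prod_normE /= le_max lexx orbT.
have fixE z : Fix_on (C `*` setT) (Qmap C K) (pz z) <-> K (p z) z.
  split=> [[_ []]|Kz] //; exact: (conj (conj (pC z) I) (conj (pP z) Kz)).
suff minty : minty_projected_solutions C K f !=set0.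
  (* The same [z0] serves: under the upper sign property the Minty inequality is used along the
     segment from [z0] to [y], which stays in the convex set [K x0]; otherwise pseudomonotonicity of
     [-f] reverses the inequality at once. *)
  split=> // hf; have [x0 [Cx0 [z0 [Kz0 fz0] xz0]]] := minty.
  exists x0; split => //; exists z0 => //; split => // y Ky.
  case: hf => [usp|pm]; last first.
    have := pm y z0 I I; rewrite oppr_ge0 oppr_le0; apply; exact: fz0.
  apply: usp => // t /andP[t0 t1]; apply: fz0.
  move/convex_setP: (K_convex _ Cx0) => /(_ y z0 t Ky Kz0); rewrite addrC.
  by apply; rewrite !ltW.
apply: contrapT => no_minty.
have G_nonempty z : K (p z) z -> Gmap K f (pz z) !=set0.
  move=> Kz; apply: contrapT => noG; apply: no_minty; exists (p z); split=> //.
  exists z => //; split=> // y Ky; rewrite leNgt; apply/negP => fyz.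
  by apply: noG; exists y.
pose H z := [set y | (K (p z) z -> finite_hull (Gmap K f (pz z)) y)
                  /\ (~ K (p z) z -> K (p z) y)].
have G_sub z : finite_hull (Gmap K f (pz z)) `<=` K (p z).
  by apply: finite_hull_sub; [exact: K_convex|move=> y []].
have H_sub z : H z `<=` K (p z).
  move=> y [Gy Ky]; have [Kz|nKz] := pselect (K (p z) z); last exact: Ky.
  exact/G_sub/Gy.
have H_lsc : lsc H.
  move=> z y e Hy e0; have Ky := H_sub _ _ Hy; have [Gy _] := Hy.
  have K_near := K_lsc z y e Ky e0.
  have [Kz|nKz] := pselect (K (p z) z); last first.
    (* Closedness of the fixed point set of [Q] makes all nearby points non-fixed, and there [H] is
       [K]. *)
    have nfix : \forall z' \near z, ~ K (p z') z'.
      have : \forall q \near pz z, ~ Fix_on (C `*` setT) (Qmap C K) q.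
        apply: open_nbhs_nbhs; split; first exact: closed_openC.
        by move/fixE.
      by move/pz_near; apply: filterS => z' nf /fixE.
    near=> z'; have [|y' Ky' yy'] := near K_near z' => //.
    exists y' => //; split => // Kz'; suff : ~ K (p z') z' by [].
    by near: z'.
  (* [y] lies in the hull of finitely many points of [G], each of which has close values of [G] at
     nearby fixed points; at nearby non-fixed points [K_near] suffices. *)
  have [m [x [Gx hy]]] := Gy Kz.
  have G_near : \forall z' \near z, forall i, K (p z') z' ->
      exists2 x', Gmap K f (pz z') x' & `|x i - x'| < e.
    apply: (@filter_forall _ _ (fun i z' => K (p z') z' ->
      exists2 x', Gmap K f (pz z') x' & `|x i - x'| < e) _ (nbhs_filter z)) => i.
    have /pz_near := @lower_semicontinuous_near R _ _ _ _ (pz z) (x i) e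
      G_lsc ((fixE z).2 Kz) (Gx i) e0.
    by apply: filterS => z' Gz' /fixE.
  apply: filterS2 K_near G_near => z' [y' Ky' yy'] Gz'.
  have [Kz'|nKz'] := pselect (K (p z') z'); last by exists y'.
  have /choice[x' x'P] : forall i, exists x',
      Gmap K f (pz z') x' /\ `|x i - x'| < e.
    by move=> i; have [x' Gx' xx'] := Gz' i Kz'; exists x'.
  have [|w hw yw] := @convex_hull_near R _ m x x' y e _ hy.
    by move=> i; have [] := x'P i.
  exists w => //; split => // _; exists m, x'; split => // i.
  by have [] := x'P i.
have [z [Gz Kz]] : exists z, H z z.
  apply: (@lsc_fixpoint R n H M H_lsc) => [z|z|z y /H_sub]; last exact: KM.
    apply/convex_setP => y y' t [Gy Ky] [Gy' Ky'] t01; split=> [Kz|nKz].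
      have /convex_setP := @finite_hull_convex R _ (Gmap K f (pz z)).
      by apply => //; [exact: Gy|exact: Gy'].
    have /convex_setP := K_convex _ (pC z).
    by apply => //; [exact: Ky|exact: Ky'].
  have [Kz|nKz] := pselect (K (p z) z).
    by have [y] := finite_hull_nonempty (G_nonempty _ Kz); exists y.
  by have [y Ky] := K_nonempty _ (pC z); exists y.
(* In either case a fixed point of [H] yields a fixed point [(p z, z)] of [Q]. *)
have Kpz : K (p z) z by apply: contrapT => nKz; exact/nKz/Kz.
have [m [x [Gx hz]]] := Gz Kpz.
(* The points [x i] lie in [K (p z)] with [f (x i) z > 0], although [z] is in their hull. *)
have [i] : exists i, f (x i) z <= 0.
  apply: f_pqm hz => i; apply: sub_convex_hull.
  by exists (p z); [exact: pC|have [] := Gx i].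
by rewrite leNgt; have [_ ->] := Gx i.
Unshelve. all: by end_near.
Qed.
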